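(* Let $T\ge 1$, let $\Sigma_u$ be a symmetric positive definite $T\times T$ matrix, and let $\mathcal{U}$ be a Gaussian process on $\mathbb{R}^T\times\mathbb{R}^T$ with covariance $$k_u([x,y],[v,w])=\sigma_u^2\exp\left(-\tfrac12 (x-v)^\intercal\Sigma_u^{-1}(x-v)-\tfrac12 (y-w)^\intercal\Sigma_u^{-1}(y-w)\right),\qquad \sigma_u>0.$$ Let $\mathcal{F}(x,y)=\mathcal{U}(x,y)-\mathcal{U}(y,x)$ with $\mathbb{E}[\mathcal{F}(x,y)]=0$ for all $x,y$. Let the attributes be i.i.d. multivariate Gaussian with covariance $\Sigma_x=\sigma_x^2 I$, drawn independently of $\mathcal{F}$, and suppose $\Sigma_u^{-1}\Sigma_x=r^2I$ with $r>0$. Then the shared-endpoint correlation $\rho(r)$ satisfies, as $r\to0$, $$\rho(r)=\frac12\left[1-\frac{T-1}{2}r^2+\mathcal{O}(r^4)\right],$$ and in particular $\rho(r)\to\tfrac12$.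
   Context: Let $X,Y,W$ be i.i.d. draws from the attribute distribution $\pi_X$, independent of the random skew-symmetric function $\mathcal{F}$. The variance and the shared-endpoint correlation are $$\sigma^2=\mathbb{E}_{\mathcal{F}}\left[\mathrm{Var}_{X,Y}(\mathcal{F}(X,Y)\mid\mathcal{F})\right],\qquad \rho=\frac{1}{\sigma^2}\,\mathbb{E}_{\mathcal{F}}\left[\mathrm{Cov}_{X,Y,W}(\mathcal{F}(X,Y),\mathcal{F}(X,W)\mid\mathcal{F})\right].$$ Under these hypotheses $\rho$ depends only on $r$ and $T$. *)

(* Defs.v *)
From HB Require Import structures.
From mathcomp Require Export all_boot all_order all_algebra.
From mathcomp Require Export all_classical all_reals all_analysis.
Export Order.TTheory GRing.Theory Num.Theory.
Export numFieldNormedType.Exports.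

Set Implicit Arguments.
Unset Strict Implicit.
Unset Printing Implicit Defensive.

Local Open Scope classical_set_scope.
Local Open Scope ring_scope.

(* Points of R^n are n-tuples, because these carry the library's product
   (Borel) sigma-algebra; linear algebra is done on the associated column
   vectors. *)
Definition col_of_tuple (R : realType) n (x : n.-tuple R) : 'cV[R]_n :=
  \col_i tnth x i.

Definition tuple_of_col (R : realType) n (v : 'cV[R]_n) : n.-tuple R :=
  [tuple v i 0 | i < n].

Definition quad_form (R : realType) n (S : 'M[R]_n) (v : 'cV[R]_n) : R :=
  (v^T *m S *m v) 0 0.

Definition sym_posdef (R : realType) n (S : 'M[R]_n) : Prop :=
  S^T = S /\ forall v : 'cV[R]_n, v != 0 -> 0 < quad_form S v.

(* The law of n independent N(0,1) variables; the product formula on measurable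
   boxes determines the measure. *)
Definition std_normal_law (R : realType) n (nu : set (n.-tuple R) -> \bar R) :
  Prop :=
  forall B : 'I_n -> set R, (forall i, measurable (B i)) ->
    nu [set z | forall i, B i (tnth z i)] =
    (\prod_(i < n) normal_prob (0 : R) 1 (B i))%E.

(* N(mu, S) as the law of mu + A Z with Z standard normal and A A^T = S; S may
   be singular, as needed for finite-dimensional marginals at repeated points. *)
Definition multivariate_normal_law (R : realType) n (mu : 'cV[R]_n)
    (S : 'M[R]_n) (pi : set (n.-tuple R) -> \bar R) : Prop :=
  exists (nu : probability (n.-tuple R) R) (A : 'M[R]_n),
    [/\ std_normal_law nu, A *m A^T = S &
        forall B : set (n.-tuple R), measurable B ->
          pi B = nu [set z | B (tuple_of_col (mu + A *m col_of_tuple z))]].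

(* The mean function is left free. *)
Definition gaussian_process (R : realType) (d : measure_display)
    (Omega : measurableType d) (P : probability Omega R) (I : Type)
    (U : Omega -> I -> R) (k : I -> I -> R) : Prop :=
  (forall s, measurable_fun [set: Omega] (U^~ s)) /\
  exists m : I -> R, forall n (s : 'I_n -> I),
    multivariate_normal_law (\col_i m (s i)) (\matrix_(i, j) k (s i) (s j))
      (pushforward P (fun w => [tuple U w (s i) | i < n])).

Definition k_u (R : realType) n (sigma_u : R) (Su : 'M[R]_n)
    (p q : n.-tuple R * n.-tuple R) : R :=
  sigma_u ^+ 2 *
  expR (- 2^-1 * quad_form (invmx Su) (col_of_tuple p.1 - col_of_tuple q.1)
        - 2^-1 * quad_form (invmx Su) (col_of_tuple p.2 - col_of_tuple q.2)).

Definition skew_part (Omega V : Type) (R : realType) (U : Omega -> V * V -> R)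
    (w : Omega) (x y : V) : R :=
  U w (x, y) - U w (y, x).

Definition identically_distributed (R : realType) (d d' : measure_display)
    (Omega : measurableType d) (V : measurableType d') (Q : probability Omega R)
    (X Y : {RV Q >-> V}) : Prop :=
  forall A : set V, measurable A -> distribution Q X A = distribution Q Y A.

(* Taking some of the sets to be full gives the product rule for subfamilies. *)
Definition mutually_independent3 (R : realType) (d d' : measure_display)
    (Omega : measurableType d) (V : measurableType d') (Q : probability Omega R)
    (X Y W : {RV Q >-> V}) : Prop :=
  forall A B C : set V, measurable A -> measurable B -> measurable C ->
    Q (X @^-1` A `&` Y @^-1` B `&` W @^-1` C) =
    (Q (X @^-1` A) * Q (Y @^-1` B) * Q (W @^-1` C))%E.

Definition iid3 (R : realType) (d d' : measure_display)
    (Omega : measurableType d) (V : measurableType d') (Q : probability Omega R)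
    (X Y W : {RV Q >-> V}) : Prop :=
  [/\ identically_distributed X Y, identically_distributed X W &
      mutually_independent3 X Y W].

(* The random function F lives on (Omega, P) and the attributes on (Omega', Q):
   they are independent because the underlying experiment is the product space
   Omega * Omega'.  Conditioning on F therefore amounts to fixing w : Omega and
   integrating over Omega' only. *)
Section shared_endpoint_correlation.
Context (R : realType) (d d' dV : measure_display).
Context (Omega : measurableType d) (Omega' : measurableType d').
Context (V : measurableType dV).
Context (P : probability Omega R) (Q : probability Omega' R).
Variables (F : Omega -> V -> V -> R) (X Y W : {RV Q >-> V}).

Definition edge_variance : \bar R :=
  (\int[P]_w 'V_Q[fun w' => F w (X w') (Y w')])%E.

Definition shared_endpoint_covariance : \bar R :=
  (\int[P]_w covariance Q (fun w' => F w (X w') (Y w'))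
                          (fun w' => F w (X w') (W w')))%E.

Definition shared_endpoint_correlation : R :=
  (fine edge_variance)^-1 * fine shared_endpoint_covariance.

End shared_endpoint_correlation.

(* Main.v *)
From HB Require Import structures.
Require Import Defs.
From mathcomp Require Import measurable_realfun ring lra.

Set Implicit Arguments.
Unset Strict Implicit.
Unset Printing Implicit Defensive.

Local Open Scope classical_set_scope.
Local Open Scope ring_scope.

(* Given F, exchangeability of the endpoints makes F(X, Y) centred, so by Fubini
   the variance and the covariance are E[c((X, Y), (X, Y))] and
   E[c((X, Y), (X, W))], where c is the covariance kernel of F.  Here
   Sigma_u^-1 is the scalar matrix r^2 / sigma_x^2, so c is a combination of
   products of two isotropic Gaussian kernels g, and
     rho = (E[g(Y, W)] - E[g(X, W) g(X, Y)]) / (1 - E[g(X, Y)^2]).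
   Completing the square coordinate by coordinate gives, with x = r^2,
     rho = ((1 + 2x)^(-T/2) - ((1 + x) (1 + 3x))^(-T/2)) / (1 - (1 + 4x)^(-T/2)),
   and the claim is the second-order expansion of numerator and denominator. *)

(** * Integrals and laws *)

(** Numerator and denominator of rho both vanish to first order, like T x and 2 T x. Their quotient
    gives the limit 1/2, but the division costs one order: an O(x^2) error in rho requires
    expansions with an x^3 remainder and a linear lower bound on the denominator. On the
    probabilistic side, laws are known only through their values on boxes and through maps z |-> mu
    + A z, so every moment, even E[Z_i] = 0 and E[Z_i Z_j] = delta_ij, comes from transporting an
    identity between measures of sets to integrals. Neither the mean of U nor that of the attributes
    is prescribed: the first drops out because F is centred, the second because the kernel sees only
    differences of attributes. Fubini rests on the diagonal of c, bounded by 2 sigma_u^2, which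
    controls the mean of a product of two values of F; the same factor 2 sigma_u^2 cancels in
    rho. *)

Section transport.
Local Open Scope ereal_scope.
Context d1 d2 (T1 : measurableType d1) (T2 : measurableType d2) (R : realType).
Variables (m1 : {measure set T1 -> \bar R}) (m2 : {measure set T2 -> \bar R}).
Variables (phi : T1 -> T2) (h : T1 -> R) (g : T2 -> R).
Hypotheses (mphi : measurable_fun [set: T1] phi).
Hypotheses (mh : measurable_fun [set: T1] h) (h0 : forall x, (0 <= h x)%R).
Hypotheses (mg : measurable_fun [set: T2] g) (g0 : forall y, (0 <= g y)%R).

Import HBNNSimple.

(** Simple functions and monotone convergence extend the identity from indicators to [f]. The two
    weights cover both uses: passing from a law to its density, and replacing one factor of a
    product while the other factors act as the weight. *)
Lemma ge0_integral_weighted_transport (f : T2 -> \bar R) :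
  (forall A, measurable A ->
    \int[m1]_x (\1_A (phi x) * h x)%:E = \int[m2]_y (\1_A y * g y)%:E) ->
  measurable_fun [set: T2] f -> (forall y, 0 <= f y) ->
  \int[m1]_x (f (phi x) * (h x)%:E) = \int[m2]_y (f y * (g y)%:E).
Proof.
move=> H mf f0.
pose f_ := nnsfun_approx measurableT mf.
have ndf x a b : (a <= b)%N -> (f_ a x <= f_ b x)%R.
  by move=> ab; exact/lefP/nd_nnsfun_approx.
have cvgf y : (f_ n y)%:E @[n --> \oo] --> f y.
  by apply: cvg_nnsfun_approx.
have lim1 d (T : measurableType d) (m : {measure set T -> \bar R})
    (p : T -> T2) (k : T -> R) : measurable_fun setT p ->
    measurable_fun setT k -> (forall x, 0 <= k x)%R ->
    \int[m]_x (f (p x) * (k x)%:E) =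
    limn (fun n => \int[m]_x ((f_ n (p x))%:E * (k x)%:E)).
  move=> mp mk k0; rewrite -monotone_convergence//.
  - apply: eq_integral => x _; apply/esym/cvg_lim => //.
    exact: cvgeZr.
  - move=> n; apply: emeasurable_funM; apply/measurable_EFinP => //.
    exact: measurableT_comp.
  - by move=> n x _; rewrite mule_ge0// lee_fin.
  - by move=> x _ a b ab; rewrite lee_wpmul2r// lee_fin ?ndf.
rewrite lim1// (lim1 _ _ _ idfun)//; last exact: measurable_id.
congr (limn _); apply/funext => n.
have sf d (T : measurableType d) (m : {measure set T -> \bar R})
    (p : T -> T2) (k : T -> R) : measurable_fun setT p ->
    measurable_fun setT k -> (forall x, 0 <= k x)%R ->
    \int[m]_x ((f_ n (p x))%:E * (k x)%:E) =
    \sum_(r \in range (f_ n)) (r%:E *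
      \int[m]_x ((\1_(f_ n @^-1` [set r]) (p x) * k x)%:E)).
  move=> mp mk k0.
  have mI r : measurable_fun [set: T]
      (fun x => (\1_(f_ n @^-1` [set r]) (p x) * k x)%:E).
    apply/measurable_EFinP; apply: measurable_funM => //.
    exact: measurableT_comp.
  under eq_integral => x _.
    rewrite fimfunE -fsumEFin// ge0_mule_fsuml; last first.
      by move=> r; rewrite EFinM nnfun_muleindic_ge0.
    over.
  rewrite ge0_integral_fsum//; last 2 first.
  - move=> r; apply: emeasurable_funM; apply/measurable_EFinP => //.
    by apply: measurable_funM => //; exact: measurableT_comp.
  - move=> r x _; rewrite EFinM mule_ge0 ?lee_fin//.
    by rewrite -lee_fin EFinM nnfun_muleindic_ge0.
  apply: eq_fsbigr => r; rewrite inE => -[y _ ry].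
  under eq_integral do rewrite -EFinM -mulrA EFinM.
  rewrite ge0_integralZl//.
  - by move=> x _; rewrite lee_fin mulr_ge0.
  - by rewrite lee_fin -ry.
rewrite sf// (sf _ _ _ idfun)//; last exact: measurable_id.
by apply: eq_fsbigr => r _; rewrite H.
Qed.

End transport.

Lemma integral_normal_probE (R : realType) (m s : R) (f : R -> \bar R) :
  measurable_fun [set: R] f -> (forall x, 0 <= f x)%E ->
  (\int[normal_prob m s]_x f x =
   \int[lebesgue_measure]_x (f x * (normal_pdf m s x)%:E))%E.
Proof.
move=> mf f0.
under [LHS]eq_integral do rewrite -[f _]mule1.
apply: (@ge0_integral_weighted_transport _ _ _ _ _ _ _ idfun (cst 1%R)) => //.
- exact: measurable_id.
- exact: measurable_normal_pdf.
- by move=> y; exact: normal_pdf_ge0.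
- move=> A mA; under eq_integral do rewrite mulr1.
  rewrite integral_indic//= setIT /normal_prob [LHS]integral_mkcond.
  apply: eq_integral => x _; rewrite patchE indicE.
  by case: ifPn; rewrite ?mul1r ?mul0r.
Qed.

Lemma ge0_integral_same_law d1 d2 d (T1 : measurableType d1)
    (T2 : measurableType d2) (T : measurableType d) (R : realType)
    (m1 : {measure set T1 -> \bar R}) (m2 : {measure set T2 -> \bar R})
    (p1 : T1 -> T) (p2 : T2 -> T) (f : T -> \bar R) :
  measurable_fun [set: T1] p1 -> measurable_fun [set: T2] p2 ->
  (forall A, measurable A -> m1 (p1 @^-1` A) = m2 (p2 @^-1` A)) ->
  measurable_fun [set: T] f -> (forall y, 0 <= f y)%E ->
  (\int[m1]_x f (p1 x) = \int[m2]_x f (p2 x))%E.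
Proof.
move=> mp1 mp2 H mf f0.
rewrite -[LHS](@ge0_integral_pushforward _ _ _ _ _ _ mp1 m1 setT)//.
rewrite -[RHS](@ge0_integral_pushforward _ _ _ _ _ _ mp2 m2 setT)//.
by apply: eq_measure_integral => A mA _; exact: H.
Qed.

(** Positive and negative parts are transported separately, so the identity also covers infinite and
    undefined integrals, as [skew_expectation_eq0] requires. *)
Lemma integral_same_law d1 d2 d (T1 : measurableType d1)
    (T2 : measurableType d2) (T : measurableType d) (R : realType)
    (m1 : {measure set T1 -> \bar R}) (m2 : {measure set T2 -> \bar R})
    (p1 : T1 -> T) (p2 : T2 -> T) (f : T -> \bar R) :
  measurable_fun [set: T1] p1 -> measurable_fun [set: T2] p2 ->
  (forall A, measurable A -> m1 (p1 @^-1` A) = m2 (p2 @^-1` A)) ->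
  measurable_fun [set: T] f ->
  (\int[m1]_x f (p1 x) = \int[m2]_x f (p2 x))%E.
Proof.
move=> mp1 mp2 H mf; rewrite integralE [RHS]integralE; congr (_ - _)%E.
  rewrite (funepos_comp f p1) (funepos_comp f p2).
  apply: (@ge0_integral_same_law _ _ _ _ _ _ _ _ _ p1 p2 (f^\+%E)) => //.
  exact: measurable_funepos.
rewrite (funeneg_comp f p1) (funeneg_comp f p2).
apply: (@ge0_integral_same_law _ _ _ _ _ _ _ _ _ p1 p2 (f^\-%E)) => //.
exact: measurable_funeneg.
Qed.

Section integral_is.
Context d (T : measurableType d) (R : realType) (m : {measure set T -> \bar R}).
Implicit Types (f g : T -> R) (u v : R).

(** Value and integrability travel together, because each use of linearity consumes the
    integrability of both terms. *)
Definition integral_is f v :=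
  m.-integrable setT (EFin \o f) /\ (\int[m]_x (f x)%:E = v%:E)%E.

Lemma integral_isD f g u v : integral_is f u -> integral_is g v ->
  integral_is (fun x => f x + g x) (u + v).
Proof.
move=> [intf Ef] [intg Eg]; split; first exact: (integrableD _ intf intg).
by under eq_integral do rewrite EFinD; rewrite integralD// Ef Eg.
Qed.

Lemma integral_isZ k f u :
  integral_is f u -> integral_is (fun x => k * f x) (k * u).
Proof.
move=> [intf Ef]; split; first exact: (integrableZl _ k intf).
by under eq_integral do rewrite EFinM; rewrite integralZl// Ef.
Qed.

Lemma integral_is_sum (I : Type) (s : seq I) (f : I -> T -> R) (u : I -> R) :
  (forall i, integral_is (f i) (u i)) ->
  integral_is (fun x => \sum_(i <- s) f i x) (\sum_(i <- s) u i).
Proof.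
move=> H; elim: s => [|i s IH].
  rewrite big_nil; under eq_fun do rewrite big_nil.
  by split; [exact: integrable0 | rewrite integral0].
rewrite big_cons; under eq_fun do rewrite big_cons.
exact: integral_isD.
Qed.

Lemma ge0_integral_is f u : measurable_fun setT f -> (forall x, 0 <= f x) ->
  (\int[m]_x (f x)%:E = u%:E)%E -> integral_is f u.
Proof.
move=> mf f0 Ef; split => //; apply/integrableP; split.
  exact/measurable_EFinP.
by under eq_integral do rewrite /= ger0_norm//; rewrite Ef ltry.
Qed.

End integral_is.

Lemma integral_is_cst d (T : measurableType d) (R : realType)
  (P : probability T R) (c : R) : integral_is P (fun=> c) c.
Proof.
split; first exact: finite_measure_integrable_cst.
by rewrite integral_cst//= probability_setT mule1.
Qed.

Lemma integral_is_same_law d1 d2 d (T1 : measurableType d1)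
    (T2 : measurableType d2) (T : measurableType d) (R : realType)
    (m1 : {measure set T1 -> \bar R}) (m2 : {measure set T2 -> \bar R})
    (p1 : T1 -> T) (p2 : T2 -> T) (f : T -> R) v :
  measurable_fun [set: T1] p1 -> measurable_fun [set: T2] p2 ->
  (forall A, measurable A -> m1 (p1 @^-1` A) = m2 (p2 @^-1` A)) ->
  measurable_fun [set: T] f ->
  integral_is m1 (f \o p1) v -> integral_is m2 (f \o p2) v.
Proof.
move=> mp1 mp2 H mf [/integrableP[_ intf] Ef]; split.
  apply/integrableP; split; first by apply/measurable_EFinP/measurableT_comp.
  rewrite -[ltLHS](@ge0_integral_same_law _ _ _ _ _ _ _ m1 m2 p1 p2
    (fun x => `|(f x)%:E|%E))//.
  by apply: measurableT_comp => //; exact/measurable_EFinP.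
rewrite -Ef; apply/esym.
apply: (@integral_same_law _ _ _ _ _ _ _ m1 m2 p1 p2 (EFin \o f)) => //.
exact/measurable_EFinP.
Qed.

(** For [x >= 0] this is E[exp(- x Z^2 / 2)] with Z standard normal. *)
Definition isqrt1p (R : realType) (x : R) : R := (Num.sqrt (1 + x))^-1.

(** With q = sqrt(1 + s) and s = q^2 - 1, both gaps are (q - 1)^2 times a positive factor. The
    bounds agree to first order at 0, which is what pins the second moment of N(0,1) to 1. *)
Lemma one_minus_isqrt1p_bounds (R : realType) (s : R) : 0 < s ->
  s / (2 * (1 + s)) <= 1 - isqrt1p s <= s / 2.
Proof.
rewrite /isqrt1p => s0; have q2 : Num.sqrt (1 + s) ^+ 2 = 1 + s by rewrite sqr_sqrtr//; lra.
have q1 : 1 < Num.sqrt (1 + s) by rewrite -[X in X < _]sqrtr1 ltr_sqrt; lra.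
move: q2 q1; set q := Num.sqrt _ => q2 q1.
rewrite -q2; have -> : s = q ^+ 2 - 1 by rewrite q2; ring.
have q0 : q != 0 by rewrite gt_eqF//; lra.
rewrite -subr_ge0 -[X in _ && X]subr_ge0; apply/andP; split.
  rewrite [leRHS](_ : _ = ((q - 1) / q) ^+ 2 / 2); last by field.
  by rewrite divr_ge0 ?sqr_ge0.
rewrite [leRHS](_ : _ = (q - 1) ^+ 2 * (q + 2) / (2 * q)); last by field.
by rewrite divr_ge0 ?mulr_ge0 ?sqr_ge0//; lra.
Qed.

(** * Gaussian integrals *)

Section standard_normal.
Variable R : realType.
Local Notation N := (normal_prob (0 : R) 1).

Lemma normal_prob_gauss (s a : R) : 0 <= s ->
  integral_is N (fun c => expR (- (s / 2) * (a - c) ^+ 2))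
    ((Num.sqrt (1 + s))^-1 * expR (- (s / (2 * (1 + s))) * a ^+ 2)).
Proof.
move=> s0; apply: ge0_integral_is.
- apply: measurableT_comp => //; apply: measurable_funM => //.
  by apply: measurable_funX; exact: measurable_funB.
- by move=> x; exact: expR_ge0.
rewrite integral_normal_probE; last 2 first.
- apply/measurable_EFinP; apply: measurableT_comp => //.
  apply: measurable_funM => //.
  by apply: measurable_funX; exact: measurable_funB.
- by move=> x; rewrite lee_fin expR_ge0.
set q := Num.sqrt (1 + s).
have q0 : 0 < q by rewrite sqrtr_gt0; lra.
have q2 : q ^+ 2 = 1 + s by rewrite sqr_sqrtr//; lra.
have s1 : 1 + s != 0 by apply/eqP; lra.
have qV0 : q^-1 != 0 by rewrite invr_neq0// gt_eqF.
(* Since s (a - c)^2 + c^2 = (1 + s) (c - s a / (1 + s))^2 + s a^2 / (1 + s), the integrand is a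
   constant times the density with mean s a / (1 + s) and standard deviation 1 / q. *)
transitivity (\int[lebesgue_measure]_x
  ((q^-1 * expR (- (s / (2 * (1 + s))) * a ^+ 2))%:E *
   (normal_pdf (s * a / (1 + s)) q^-1 x)%:E))%E.
  apply: eq_integral => c _; rewrite -!EFinM; congr EFin.
  rewrite !normal_pdfE//= ?oner_neq0// /normal_peak /normal_fun.
  have -> : Num.sqrt (q^-1 ^+ 2 * pi *+ 2) = q^-1 * Num.sqrt (1 ^+ 2 * pi *+ 2) :> R.
    rewrite -mulrnAr sqrtrM ?sqr_ge0// sqrtr_sqr ger0_norm ?invr_ge0 ?ltW//.
    by rewrite expr1n mul1r.
  rewrite (invfM q^-1) invrK mulrCA -expRD.
  set p := (Num.sqrt _)^-1.
  have assoc (x y z t : R) : x != 0 -> x^-1 * y * (x * z * t) = z * (y * t).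
    by move=> x0; field.
  rewrite assoc ?gt_eqF// -expRD; congr (p * expR _).
  rewrite exprVn q2; field; exact: s1.
rewrite integralZl//; last exact: integrable_normal_pdf.
by rewrite integral_normal_pdf mule1.
Qed.

Lemma normal_prob_sym (A : set R) : measurable A -> N (-%R @^-1` A) = N A.
Proof.
move=> mA; rewrite /normal_prob [LHS]integral_mkcond [RHS]integral_mkcond.
have mNA : measurable (-%R @^-1` A : set R).
  by rewrite -[X in measurable X]setTI; exact: oppr_measurable.
have mf (B : set R) : measurable B -> measurable_fun [set: R]
    ((fun x => (normal_pdf 0 1 x)%:E) \_ B).
  move=> mB; apply/(measurable_restrictT _ _).1 => //.
  apply/measurable_EFinP; apply: measurable_funTS; exact: measurable_normal_pdf.
transitivity (\int[lebesgue_measure]_x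
    (((fun x => (normal_pdf 0 1 x)%:E) \_ (-%R @^-1` A : set R)) (- x)%R))%E.
  have := @ge0_integral_same_law _ _ _ (measurableTypeR R) (measurableTypeR R)
    (measurableTypeR R) _ lebesgue_measure lebesgue_measure idfun
    (-%R : R -> R)
    ((fun x => (normal_pdf 0 1 x)%:E) \_ (-%R @^-1` A : set R)); apply.
  - exact: measurable_id.
  - exact: oppr_measurable.
  - by move=> B mB; exact/esym/lebesgue_measureN.
  - exact: mf.
  - by move=> x; rewrite patchE; case: ifPn => // _; rewrite lee_fin normal_pdf_ge0.
apply: eq_integral => x _; rewrite !patchE.
have -> : (- x \in (-%R @^-1` A : set R)) = (x \in A).
  by apply/idP/idP; rewrite !inE /preimage/= opprK.
by case: ifPn => // _; rewrite !normal_pdfE ?oner_neq0// /normal_fun !subr0 sqrrN.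
Qed.

Lemma normal_prob_sqr : integral_is N (fun x => x ^+ 2) 1.
Proof.
have mX : measurable_fun [set: R] (fun x : R => x ^+ 2) by exact: measurable_funX.
apply: ge0_integral_is => //; first by move=> x; exact: sqr_ge0.
have gs (s : R) : 0 <= s ->
    (\int[N]_x (expR (- (s / 2) * x ^+ 2))%:E = (isqrt1p s)%:E)%E.
  move=> s0; have [_] := normal_prob_gauss 0 s0.
  rewrite expr0n/= mulr0 expR0 mulr1 => <-.
  by apply: eq_integral => x _; rewrite sub0r sqrrN.
have ig (s : R) : 0 <= s ->
    integral_is N (fun x => 1 - expR (- (s / 2) * x ^+ 2)) (1 - isqrt1p s).
  move=> s0; apply: integral_isD; first exact: integral_is_cst.
  have -> : (fun x : R => - expR (- (s / 2) * x ^+ 2)) =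
      (fun x => - 1 * expR (- (s / 2) * x ^+ 2)).
    by apply/funext => x; rewrite mulN1r.
  rewrite -[X in integral_is _ _ X]mulN1r; apply: integral_isZ.
  apply: ge0_integral_is; [|by move=> x; exact: expR_ge0|exact: gs].
  by apply: measurableT_comp => //; exact: measurable_funM.
(* Both bounds come from the first-order behaviour at s = 0 of the integral of
   1 - exp (- s x^2 / 2): Fatou's lemma for one, [1 - exp (- u) <= u] for the
   other. *)
have le1 : (\int[N]_x (x ^+ 2)%:E <= 1)%E.
  (* With s = 1 / (n + 1) and u = s x^2 / 2 this is (2 / s) u / (1 + u). It tends to x^2 and stays
     below (2 / s) (1 - exp(- u)), because exp(- u) <= 1 / (1 + u); the integral of that bound is at
     most 1. *)
  pose f (n : nat) (x : R) := (x ^+ 2 * (1 + n.+1%:R^-1 / 2 * x ^+ 2)^-1)%:E.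
  have p0 n (x : R) : 0 < 1 + n.+1%:R^-1 / 2 * x ^+ 2.
    by rewrite ltr_pwDl// mulr_ge0 ?sqr_ge0// divr_ge0.
  have cvgf x : f n x @[n --> \oo] --> (x ^+ 2)%:E.
    apply: cvg_EFin; first exact: nearW.
    rewrite -[X in _ --> X]mulr1; apply: cvgM; first exact: cvg_cst.
    rewrite -[X in _ --> X]invr1; apply: cvgV; first exact: oner_neq0.
    rewrite -[X in _ --> X]addr0; apply: cvgD; first exact: cvg_cst.
    rewrite -[X in _ --> X](mul0r (x ^+ 2)); apply: cvgM; last exact: cvg_cst.
    rewrite -[X in _ --> X](mul0r (2^-1)); apply: cvgM; last exact: cvg_cst.
    exact: cvg_harmonic.
  have mf n : measurable_fun [set: R] (f n).
    apply/measurable_EFinP; apply: measurable_funM => //.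
    apply: continuous_measurable_fun => x; apply: cvgV; first by rewrite gt_eqF.
    apply: cvgD; first exact: cvg_cst.
    by apply: cvgM; [exact: cvg_cst | exact: sqr_continuous].
  have f0 n x : (0 <= f n x)%E.
    by rewrite lee_fin mulr_ge0 ?sqr_ge0// invr_ge0 ltW.
  have fle n : (\int[N]_x f n x <= 1)%E.
    set s : R := n.+1%:R^-1; have s0 : 0 < s by rewrite invr_gt0.
    have [_ Es] := integral_isZ (2 / s) (ig s (ltW s0)).
    apply: (@le_trans _ _ (2 / s * (1 - isqrt1p s))%:E); last first.
      rewrite lee_fin -ler_pdivlMl ?divr_gt0// invf_div mulr1.
      by case/andP: (one_minus_isqrt1p_bounds s0).
    rewrite -Es; apply: ge0_le_integral => //.
    + exact: mf.
    + by have [/measurable_int] := integral_isZ (2 / s) (ig s (ltW s0)).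
    + move=> x _; rewrite /f -/s lee_fin; set u := s / 2 * x ^+ 2.
      have u0 : 0 <= u by rewrite mulr_ge0 ?sqr_ge0// divr_ge0// ltW.
      rewrite [X in X / (1 + _)](_ : _ = 2 / s * u); last first.
        by rewrite /u; field; rewrite gt_eqF.
      rewrite -mulrA ler_pM2l ?divr_gt0// mulNr expRN.
      have : (expR u)^-1 <= (1 + u)^-1.
        by rewrite lef_pV2 ?posrE ?expR_gt0 ?expR_ge1Dx//; lra.
      have -> : u / (1 + u) = 1 - (1 + u)^-1 by field; rewrite gt_eqF//; lra.
      by move=> ?; rewrite lerD2l lerN2.
  rewrite (_ : (fun x => (x ^+ 2)%:E) = fun x => limn_einf (f^~ x)); last first.
    by apply/funext => x; rewrite (cvg_limn_einf_sup (cvgf x)).1.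
  apply: le_trans (fatou _ _ _ _) _ => //.
  rewrite limn_einf_lim; apply: lime_le; first exact: is_cvg_einfs.
  apply: nearW => n; apply: le_trans (fle n).
  by apply: ereal_inf_lbound; exists n => /=.
have ge0 : (0 <= \int[N]_x (x ^+ 2)%:E)%E.
  by apply: integral_ge0 => x _; rewrite lee_fin sqr_ge0.
have [v Ev] : exists v, (\int[N]_x (x ^+ 2)%:E = v%:E)%E.
  by move: le1 ge0; case: (\int[N]_x _)%E => // v; exists v.
rewrite Ev in le1 ge0 *; rewrite !lee_fin in le1 ge0; congr EFin.
have iv : integral_is N (fun x => x ^+ 2) v.
  by apply: ge0_integral_is => // x; exact: sqr_ge0.
have key (s : R) : 0 < s -> s / (2 * (1 + s)) <= s / 2 * v.
  move=> s0; have /andP[h _] := one_minus_isqrt1p_bounds s0; apply: (le_trans h).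
  have [i1 E1] := ig s (ltW s0).
  have [i2 E2] := integral_isZ (s / 2) iv.
  rewrite -lee_fin -E1 -E2; apply: le_integral => // x _; rewrite lee_fin.
  have := expR_ge1Dx (- (s / 2) * x ^+ 2); lra.
apply/eqP; rewrite eq_le le1 /= leNgt; apply/negP => v1.
(* [key] says v >= 1 / (1 + s). If v < 1, the choice s = 1 - v turns it into (1 - v)^3 <= 0. *)
have s0 : 0 < 1 - v by rewrite subr_gt0.
have := exprn_gt0 3 s0; have := key _ s0.
rewrite ler_pdivrMr; last lra.
have -> : (1 - v) ^+ 3 = (1 - v) - (1 - v) / 2 * v * (2 * (1 + (1 - v))) by field.
by rewrite subr_gt0 ltNge => ->.
Qed.

Lemma normal_prob_id : integral_is N (fun x => x) 0.
Proof.
(* The domination |x| <= 1 + x^2 makes the mean finite; only then does symmetry, mean = - mean,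
   force it to be 0. *)
have int : N.-integrable setT (EFin \o (fun x : R => x)).
  have [int2 _] := integral_isD (integral_is_cst N 1) normal_prob_sqr.
  apply: le_integrable int2 => //; first by apply/measurable_EFinP.
  move=> x _ /=; rewrite lee_fin [leRHS]ger0_norm ?addr_ge0 ?sqr_ge0//.
  rewrite ler_norml; have := sqr_ge0 (x - 1); have := sqr_ge0 (x + 1).
  by rewrite !expr2 => ? ?; apply/andP; split; nra.
split => //.
have Nid : (\int[N]_x (x%:E) = \int[N]_x (- x)%:E)%E.
  have := @integral_same_law _ _ _ (measurableTypeR R) (measurableTypeR R)
    (measurableTypeR R) _ N N idfun (-%R : R -> R) EFin; apply.
  - exact: measurable_id.
  - exact: oppr_measurable.
  - by move=> A mA; exact/esym/normal_prob_sym.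
  - exact/measurable_EFinP.
have : (\int[N]_x x%:E)%E \is a fin_num by exact: integrable_fin_num int.
have : (\int[N]_x (- x)%:E = - \int[N]_x (x%:E))%E.
  rewrite -[RHS]mulN1e -integralZl//.
  by apply: eq_integral => x _; rewrite -EFinM mulN1r.
rewrite -Nid; case: (\int[N]_x x%:E)%E => // r [] ?  _; congr EFin; lra.
Qed.
End standard_normal.

(** * Vectors of independent standard normals *)

Section std_normal.
Variables (R : realType) (n : nat) (nu : probability (n.-tuple R) R).
Hypothesis nuE : std_normal_law nu.
Local Notation N := (normal_prob (0 : R) 1).

Lemma prod_indicE (B : 'I_n -> set R) (z : n.-tuple R) :
  \prod_(i < n) (\1_(B i) (tnth z i) : R) = \1_[set z | forall i, B i (tnth z i)] z.
Proof.
rewrite indicE; have [zB|zB] := boolP (z \in _).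
  by rewrite big1// => i _; rewrite indicE mem_set//; move: zB; rewrite inE; apply.
move: zB; rewrite notin_setE/= => /existsNP[i Bi].
by rewrite (bigD1 i)//= indicE memNset// mul0r.
Qed.

Lemma measurable_box (B : 'I_n -> set R) : (forall i, measurable (B i)) ->
  measurable [set z : n.-tuple R | forall i, B i (tnth z i)].
Proof.
move=> mB; rewrite [X in measurable X](_ : _ =
    \bigcap_(i in [set: 'I_n]) ((@tnth n R)^~ i @^-1` B i)).
  apply: fin_bigcap_measurable => // i _.
  by rewrite -[X in measurable X]setTI; exact: measurable_tnth.
by apply/seteqP; split => z /= zB i => [_|]; exact: zB.
Qed.

Lemma integral_std_normal_prod (f : 'I_n -> R -> R) (v : 'I_n -> R) :
  (forall i, measurable_fun [set: R] (f i)) -> (forall i x, 0 <= f i x) ->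
  (forall i, \int[N]_x (f i x)%:E = (v i)%:E)%E ->
  (\int[nu]_z (\prod_(i < n) f i (tnth z i))%:E = (\prod_(i < n) v i)%:E)%E.
Proof.
(* The indicators of a box are replaced by general functions one coordinate at
   a time. *)
suff H (k : nat) : forall (f : 'I_n -> R -> R) (v : 'I_n -> R),
    (forall i, measurable_fun [set: R] (f i)) -> (forall i x, 0 <= f i x) ->
    (forall i, \int[N]_x (f i x)%:E = (v i)%:E)%E ->
    (forall i : 'I_n, (k <= i)%N -> exists2 B, measurable B & f i = \1_B) ->
    (\int[nu]_z (\prod_(i < n) f i (tnth z i))%:E = (\prod_(i < n) v i)%:E)%E.
  move=> mf f0 fv; apply: (H n) => // i; rewrite leqNgt ltn_ord//.
elim: k => [|k IH] {}f {}v mf f0 fv fB.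
  have /choice[B BP] : forall i : 'I_n, exists B, measurable B /\ f i = \1_B.
    by move=> i; have [B ? ?] := fB i (leq0n i); exists B.
  under eq_integral do under eq_bigr do rewrite (BP _).2.
  under eq_integral do rewrite prod_indicE.
  have mBi i : measurable (B i) by case: (BP i).
  rewrite integral_indic ?setIT//=; last exact: measurable_box.
  rewrite nuE// -prodEFin; apply: eq_bigr => i _.
  by rewrite -fv (BP i).2 integral_indic ?setIT//; exact: mBi.
have [kn|nk] := ltnP k n; last first.
  apply: IH => // i ki; have := ltn_ord i; rewrite ltnNge.
  by rewrite (leq_trans nk ki).
pose j := Ordinal kn.
pose h (z : n.-tuple R) := \prod_(i < n | i != j) f i (tnth z i).
pose c := \prod_(i < n | i != j) v i.
have mfi i : measurable_fun [set: n.-tuple R] (fun z => f i (tnth z i)).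
  by apply: measurableT_comp => //; exact: measurable_tnth.
have v0 i : 0 <= v i.
  by rewrite -lee_fin -fv; apply: integral_ge0 => x _; rewrite lee_fin.
have mh : measurable_fun [set: n.-tuple R] h.
  rewrite /h; under eq_fun do rewrite big_mkcond.
  by apply: measurable_prod => i _; case: (i != j).
under eq_integral do rewrite (bigD1 j)//= EFinM.
rewrite (bigD1 j)//=.
(* Transport along coordinate [j], with weight [h] under [nu] and the constant weight [c] under [N].
   Testing on the indicator of a set puts an indicator in position [j = k], so all factors from [k]
   on are indicators and [IH] applies. *)
rewrite (@ge0_integral_weighted_transport _ _ _ _ _ nu N (fun z => tnth z j)
  h (cst c) _ _ _ _ _ (EFin \o f j))//=.
- rewrite ge0_integralZr ?fv ?EFinM// ?lee_fin ?prodr_ge0//.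
    by apply/measurable_EFinP; exact: mf.
  by move=> x _; rewrite lee_fin.
- exact: measurable_tnth.
- by move=> z; exact: prodr_ge0.
- by move=> _; exact: prodr_ge0.
- move=> A mA.
  pose f' i := if i == j then \1_A else f i.
  pose v' i := if i == j then fine (N A) else v i.
  have f'E i : i != j -> f' i = f i by rewrite /f' => /negbTE ->.
  have v'E i : i != j -> v' i = v i by rewrite /v' => /negbTE ->.
  transitivity (\int[nu]_z (\prod_(i < n) f' i (tnth z i))%:E)%E.
    apply: eq_integral => z _; congr EFin; rewrite (bigD1 j)//= /f' eqxx; congr *%R.
    by apply: eq_bigr => i /negbTE ->.
  rewrite (IH f' v').
  + rewrite (bigD1 j)//= /v' eqxx (eq_bigr v); last by move=> i /negbTE ->.
    under eq_integral do rewrite EFinM.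
    rewrite ge0_integralZr//= ?lee_fin ?prodr_ge0//.
    * by rewrite integral_indic// setIT EFinM fineK// fin_num_measure.
    * exact/measurable_EFinP.
  + by move=> i; rewrite /f'; case: ifP.
  + by move=> i x; rewrite /f'; case: ifP.
  + move=> i; rewrite /f' /v'; case: ifP => // _.
    by rewrite integral_indic// setIT fineK// fin_num_measure.
  + move=> i ki; rewrite /f'; case: eqVneq => [_|ij]; first by exists A.
    by apply: fB; rewrite ltn_neqAle ki andbT eq_sym.
- by apply/measurable_EFinP; exact: mf.
- by move=> y; rewrite lee_fin.
Qed.

Lemma std_normal_marginal (k : 'I_n) (A : set R) : measurable A ->
  nu ((@tnth n R)^~ k @^-1` A) = N A.
Proof.
move=> mA; have := @nuE (fun i => if i == k then A else setT).
rewrite (bigD1 k)//= eqxx big1 ?mule1 => [<-|i /negbTE ->]; last 2 first.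
  by move=> i; case: ifP.
  exact: probability_setT.
congr (nu _); apply/seteqP; split => z /= => [zA i|/(_ k)]; last by rewrite eqxx.
by case: eqVneq => // ->.
Qed.

Lemma std_normal_marginal2 (k l : 'I_n) (A B : set R) : k != l ->
  measurable A -> measurable B ->
  nu ((fun z => (tnth z k, tnth z l)) @^-1` (A `*` B)) = (N A * N B)%E.
Proof.
move=> kl mA mB.
have := @nuE (fun i => if i == k then A else if i == l then B else setT).
have lk : l != k by rewrite eq_sym.
rewrite (bigD1 k)//= (bigD1 l)//= !eqxx (negbTE lk).
rewrite big1 ?mule1 => [<-|i /andP[/negbTE -> /negbTE ->]]; last 2 first.
  by move=> i; case: ifP => // _; case: ifP.
  exact: probability_setT.
congr (nu _); apply/seteqP; split => z /= => [[zA zB] i|H].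
  by case: eqVneq => [->//|_]; case: eqVneq => [->//|_].
by split; [have := H k; rewrite eqxx | have := H l; rewrite (negbTE lk) eqxx].
Qed.

Lemma std_normal_coord (k : 'I_n) : integral_is nu (fun z => tnth z k) 0.
Proof.
have := @integral_is_same_law _ _ _ (measurableTypeR R) _ (measurableTypeR R) _
  N nu idfun ((@tnth n R)^~ k) id 0; apply => //.
- exact: measurable_id.
- exact: measurable_tnth.
- by move=> A mA; exact/esym/std_normal_marginal.
- exact: normal_prob_id.
Qed.

(** The diagonal is the second moment. Off it, the values on rectangles identify the law of the pair
    as [N \x N], and Fubini leaves a product of zero means. *)
Lemma std_normal_coordM (k l : 'I_n) :
  integral_is nu (fun z => tnth z k * tnth z l) (k == l)%:R.
Proof.
have [->|kl] := eqVneq k l.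
  have := @integral_is_same_law _ _ _ (measurableTypeR R) _ (measurableTypeR R) _
    N nu idfun ((@tnth n R)^~ l) (fun x => x ^+ 2) 1; apply => //.
  - exact: measurable_id.
  - exact: measurable_tnth.
  - by move=> A mA; exact/esym/std_normal_marginal.
  - exact: normal_prob_sqr.
pose S := measurableTypeR R.
pose p (z : n.-tuple R) : S * S := (tnth z k, tnth z l).
have mp : measurable_fun [set: n.-tuple R] p.
  by apply: measurable_fun_pair; exact: measurable_tnth.
pose X : {mfun _ >-> _} := HB.pack p (isMeasurableFun.Build _ _ _ _ p mp).
pose m (x : S * S) : R := x.1 * x.2.
have mm : measurable_fun [set: S * S] m by exact: measurable_funM.
have := @integral_is_same_law _ _ _ (S * S)%type _ (S * S)%type _
  (N \x N)%E nu idfun p m 0; apply => //.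
- exact: measurable_id.
- move=> A mA.
  apply: (@product_measure_unique _ _ _ _ _ N N (distribution nu X)) => //.
  by move=> B C mB mC; exact: std_normal_marginal2.
- have int : (N \x N)%E.-integrable setT (EFin \o m).
    apply/integrable12ltyP; first exact/measurable_EFinP.
    have [/integrableP[mid int_id] _] := normal_prob_id R.
    pose a := (\int[N]_x `|x%:E|)%E.
    have afin : (a < +oo)%E by exact: int_id.
    have a0 : (0 <= a)%E by apply: integral_ge0 => x _; exact: abse_ge0.
    have E x : (\int[N]_y `|(EFin \o m) (x, y)| = `|x|%:E * a)%E.
      rewrite -ge0_integralZl ?lee_fin//; last exact: measurableT_comp.
      by apply: eq_integral => y _; rewrite /= normrM EFinM.
    under eq_integral do rewrite E.
    rewrite ge0_integralZr//; last exact: measurableT_comp.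
    by rewrite lte_mul_pinfty// ge0_fin_numE.
  split => //; rewrite -(integral12_prod_meas1 int) /fubini_F.
  have [id_int id0] := normal_prob_id R.
  under eq_integral do under eq_integral do rewrite /= /m EFinM.
  under eq_integral do rewrite /= integralZl// id0 mule0.
  by rewrite integral0.
Qed.

Lemma std_normal_linear (a : 'I_n -> R) (c : R) :
  integral_is nu (fun z => c + \sum_i a i * tnth z i) c.
Proof.
rewrite -[X in integral_is _ _ X]addr0; apply: integral_isD.
  exact: integral_is_cst.
rewrite [X in integral_is _ _ X](_ : _ = \sum_(i < n) a i * 0); last first.
  by rewrite big1// => i _; rewrite mulr0.
by apply: integral_is_sum => i; apply: integral_isZ; exact: std_normal_coord.
Qed.

Lemma std_normal_bilinear (a b : 'I_n -> R) :
  integral_is nu (fun z => (\sum_i a i * tnth z i) * (\sum_i b i * tnth z i))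
    (\sum_i a i * b i).
Proof.
have -> : \sum_i a i * b i = \sum_i \sum_j (a i * b j) * (i == j)%:R.
  apply: eq_bigr => i _; rewrite (bigD1 i)//= eqxx mulr1 big1 ?addr0// => j.
  by rewrite eq_sym => /negbTE ->; rewrite mulr0.
under eq_fun => z.
  rewrite mulr_suml; under eq_bigr => i _.
    rewrite mulr_sumr; under eq_bigr => j _ do rewrite mulrACA.
    over.
  over.
apply: integral_is_sum => i; apply: integral_is_sum => j.
by apply: integral_isZ; exact: std_normal_coordM.
Qed.

End std_normal.

(** * Second moments of a Gaussian process *)

Lemma measurable_affine (R : realType) n (mu : 'cV[R]_n) (A : 'M[R]_n) :
  measurable_fun [set: n.-tuple R]
    (fun z => tuple_of_col (mu + A *m col_of_tuple z)).
Proof.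
apply/measurable_fun_tnthP => i.
rewrite (_ : _ \o _ = fun z : n.-tuple R => mu i 0 + \sum_k A i k * tnth z k).
  apply: measurable_funD => //; apply: measurable_sum => k.
  by apply: measurable_funM => //; exact: measurable_tnth.
apply/funext => z /=; rewrite tnth_mktuple !mxE; congr +%R.
by apply: eq_bigr => k _; rewrite mxE.
Qed.

Section normal_vector.
Context (R : realType) d (Omega : measurableType d) (P : probability Omega R).
Variables (n : nat) (V : Omega -> n.-tuple R) (mu : 'cV[R]_n) (S : 'M[R]_n).
Hypothesis mV : measurable_fun [set: Omega] V.
Hypothesis VE : multivariate_normal_law mu S (pushforward P V).

Let lin (a : 'I_n -> R) (x : n.-tuple R) := \sum_i a i * tnth x i.

Let mlin a : measurable_fun [set: n.-tuple R] (lin a).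
Proof.
apply: measurable_sum => k.
by apply: measurable_funM => //; exact: measurable_tnth.
Qed.

Let lin_affine a (A : 'M[R]_n) z :
  lin a (tuple_of_col (mu + A *m col_of_tuple z)) =
  \sum_i a i * mu i 0 + \sum_k (\sum_i a i * A i k) * tnth z k.
Proof.
transitivity (\sum_i (a i * mu i 0 + \sum_k a i * A i k * tnth z k)).
  apply: eq_bigr => i _; rewrite tnth_mktuple !mxE mulrDr mulr_sumr.
  by congr +%R; apply: eq_bigr => k _; rewrite mxE mulrA.
rewrite big_split exchange_big/=; congr +%R.
by apply: eq_bigr => k _; rewrite mulr_suml.
Qed.

Lemma normal_vector_mean (a : 'I_n -> R) :
  integral_is P (fun w => \sum_i a i * tnth (V w) i) (\sum_i a i * mu i 0).
Proof.
have [nu [A [nuE _ lawE]]] := VE.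
apply: (@integral_is_same_law _ _ _ _ _ _ _ nu P
  (fun z => tuple_of_col (mu + A *m col_of_tuple z)) V (lin a)) => //.
- exact: measurable_affine.
- by move=> B mB; exact/esym/lawE.
- rewrite (_ : _ \o _ = fun z => \sum_i a i * mu i 0 +
      \sum_k (\sum_i a i * A i k) * tnth z k).
    exact: std_normal_linear.
  by apply/funext => z /=; exact: lin_affine.
Qed.

(** For mu + A Z, the two combinations lose their constant terms by hypothesis and become linear in
    Z; the mean of their product is a^T A A^T b = a^T S b. *)
Lemma normal_vector_covariance (a b : 'I_n -> R) :
  \sum_i a i * mu i 0 = 0 -> \sum_i b i * mu i 0 = 0 ->
  integral_is P
    (fun w => (\sum_i a i * tnth (V w) i) * (\sum_i b i * tnth (V w) i))
    (\sum_i \sum_j a i * b j * S i j).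
Proof.
move=> a0 b0; have [nu [A [nuE AS lawE]]] := VE.
apply: (@integral_is_same_law _ _ _ _ _ _ _ nu P
  (fun z => tuple_of_col (mu + A *m col_of_tuple z)) V
  (fun x => lin a x * lin b x)) => //.
- exact: measurable_affine.
- by move=> B mB; exact/esym/lawE.
- exact: measurable_funM.
- rewrite (_ : _ \o _ = fun z => (\sum_k (\sum_i a i * A i k) * tnth z k) *
      (\sum_k (\sum_i b i * A i k) * tnth z k)); last first.
    by apply/funext => z /=; rewrite !lin_affine a0 b0 !add0r.
  rewrite [X in integral_is _ _ X](_ : _ =
      \sum_k (\sum_i a i * A i k) * (\sum_i b i * A i k)).
    exact: std_normal_bilinear.
  under [RHS]eq_bigr do rewrite mulr_suml.
  rewrite [RHS]exchange_big/=; apply: eq_bigr => i _.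
  under [RHS]eq_bigr do rewrite mulr_sumr.
  rewrite [RHS]exchange_big/=; apply: eq_bigr => j _.
  rewrite -AS mxE mulr_sumr; apply: eq_bigr => k _.
  by rewrite mxE mulrACA.
Qed.

End normal_vector.

Section skew_gaussian_process.
Context (R : realType) d (Omega : measurableType d) (P : probability Omega R).
Variables (V : Type) (U : Omega -> V * V -> R) (k : V * V -> V * V -> R).
Hypothesis UE : gaussian_process P U k.
Hypothesis U0 : (forall x y, 'E_P[fun w => skew_part U w x y] = 0)%E.

(** Both values of F are linear in the Gaussian vector (U(x,y), U(y,x), U(v,w), U(w,v)), with
    coefficients (1,-1,0,0) and (0,0,1,-1). The mean function of U is unknown, but centredness of F
    makes its two combinations vanish. The four points may coincide, as they do for the variance. *)
Lemma skew_gaussian_covariance (x y v w : V) :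
  integral_is P (fun o => skew_part U o x y * skew_part U o v w)
    (k (x, y) (v, w) - k (x, y) (w, v) - k (y, x) (v, w) + k (y, x) (w, v)).
Proof.
have [mU [m mE]] := UE.
pose s (i : 'I_4) := nth (x, y) [:: (x, y); (y, x); (v, w); (w, v)] i.
pose a (i : 'I_4) : R := nth 0 [:: 1; -1; 0; 0] i.
pose b (i : 'I_4) : R := nth 0 [:: 0; 0; 1; -1] i.
have mV : measurable_fun [set: Omega] (fun o => [tuple U o (s i) | i < 4]).
  apply/measurable_fun_tnthP => i.
  rewrite (_ : _ \o _ = fun o => U o (s i)); first exact: mU.
  by apply/funext => o /=; rewrite tnth_mktuple.
have aE o : \sum_i a i * tnth [tuple U o (s i) | i < 4] i = skew_part U o x y.
  by rewrite !big_ord_recl big_ord0 !tnth_mktuple /a /s /skew_part /=; ring.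
have bE o : \sum_i b i * tnth [tuple U o (s i) | i < 4] i = skew_part U o v w.
  by rewrite !big_ord_recl big_ord0 !tnth_mktuple /b /s /skew_part /=; ring.
have mean0 (c : 'I_4 -> R) x' y' :
    (forall o, \sum_i c i * tnth [tuple U o (s i) | i < 4] i =
      skew_part U o x' y') ->
    \sum_i c i * (\col_i m (s i)) i 0 = 0.
  move=> cE; have [_] := normal_vector_mean mV (mE _ s) c.
  under eq_integral do rewrite cE.
  by have := U0 x' y'; rewrite unlock => -> [].
have := normal_vector_covariance mV (mE _ s) (mean0 _ _ _ aE) (mean0 _ _ _ bE).
under eq_fun do rewrite aE bE.
congr integral_is; rewrite !big_ord_recl !big_ord0 !mxE /a /b /s /=; ring.
Qed.

End skew_gaussian_process.

(** * Covariance of edges that share an endpoint *)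

(** Uniqueness of the product measure, applied to the law divided by [c]; for [c = 0] the measure
    [m] is null. The factor [c] allows [m] to be Q restricted to an event, which is how [iid3_law]
    peels off one variable. *)
Lemma scaled_product_law d d1 d2 (T : measurableType d) (T1 : measurableType d1)
    (T2 : measurableType d2) (R : realType) (m : {measure set T -> \bar R})
    (m1 : probability T1 R) (m2 : probability T2 R) (c : R)
    (X : T -> T1) (Y : T -> T2) :
  0 <= c -> measurable_fun [set: T] X -> measurable_fun [set: T] Y ->
  (forall A B, measurable A -> measurable B ->
    m (X @^-1` A `&` Y @^-1` B) = c%:E * (m1 A * m2 B))%E ->
  forall C, measurable C ->
    (m ((fun w => (X w, Y w)) @^-1` C) = c%:E * (m1 \x m2)%E C)%E.
Proof.
move=> c0 mX mY H C mC.
pose p w := (X w, Y w).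
have mp : measurable_fun [set: T] p by exact: measurable_fun_pair.
have [c_eq0|c_neq0] := eqVneq c 0.
  rewrite c_eq0 mul0e; apply/eqP; rewrite eq_le measure_ge0 andbT.
  have m0 : m [set: T] = 0%E.
    have := H setT setT measurableT measurableT.
    by rewrite !preimage_setT setIT c_eq0 mul0e.
  rewrite -m0 le_measure ?inE//.
  by rewrite -[X in measurable X]setTI; exact: mp.
have k0 : 0 <= c^-1 by rewrite invr_ge0.
pose k : {nonneg R} := NngNum k0.
pose m' : {measure set (T1 * T2) -> \bar R} := mscale k (pushforward m p).
rewrite (@product_measure_unique _ _ _ _ _ m1 m2 (m' mp))//.
  by rewrite /m' /mscale/= muleA -EFinM divff// mul1e.
move=> A B mA mB; transitivity (c^-1%:E * (c%:E * (m1 A * m2 B)))%E.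
  by rewrite -H.
by rewrite muleA -EFinM mulVf// mul1e.
Qed.

Section iid_law.
Context (R : realType) (d d' : measure_display).
Context (Omega : measurableType d) (V : measurableType d').
Context (Q : probability Omega R) (X Y W : {RV Q >-> V}).
Hypothesis XYW : iid3 X Y W.
Local Notation mu := (distribution Q X).

(** Used at the outer level, [scaled_product_law] asks for the law of (Y, W) on the event that X
    lies in [A]. That law comes from the same lemma for the restriction of Q to this event, with
    scale [mu A]. *)
Lemma iid3_law C : measurable C ->
  Q ((fun w => (X w, (Y w, W w))) @^-1` C) = (mu \x (mu \x mu))%E C.
Proof.
have [XY XW ind] := XYW => mC.
have mX := @measurable_funPT _ _ _ _ X.
have mY := @measurable_funPT _ _ _ _ Y.
have mW := @measurable_funPT _ _ _ _ W.
rewrite (@scaled_product_law _ _ _ _ _ _ _ Q mu (mu \x mu)%E 1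
  X (fun w => (Y w, W w)))//.
- by rewrite mul1e.
- exact: measurable_fun_pair.
move=> A B mA mB; rewrite mul1e.
have mXA : measurable (X @^-1` A) by rewrite -[X in measurable X]setTI; exact: mX.
transitivity (mrestr Q mXA ((fun w => (Y w, W w)) @^-1` B)).
  by rewrite /mrestr setIC.
rewrite (@scaled_product_law _ _ _ _ _ _ _ (mrestr Q mXA) mu mu (fine (mu A)))//.
- by rewrite fineK// fin_num_measure.
- by rewrite fine_ge0.
- move=> A' B' mA' mB'; rewrite fineK ?fin_num_measure//.
  transitivity (Q ((Y @^-1` A' `&` W @^-1` B') `&` X @^-1` A)) => //.
  rewrite setIC setIA ind// muleA; congr (_ * _ * _)%E.
  - exact/esym/XY.
  - exact/esym/XW.
Qed.

Lemma ge0_iid3_integral (h : V * (V * V) -> \bar R) :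
  measurable_fun [set: V * (V * V)] h -> (forall z, 0 <= h z)%E ->
  (\int[Q]_w h (X w, (Y w, W w)) =
   \int[mu]_x \int[mu]_y \int[mu]_z h (x, (y, z)))%E.
Proof.
move=> mh h0.
have mp : measurable_fun [set: Omega] (fun w => (X w, (Y w, W w))).
  by do 2 (apply: measurable_fun_pair => //).
pose mu2 : probability (V * V)%type R := (mu \x mu)%E.
pose mu3 : probability (V * (V * V))%type R := (mu \x mu2)%E.
rewrite (@ge0_integral_same_law _ _ _ _ _ _ _ Q mu3
  (fun w => (X w, (Y w, W w))) idfun h)//.
- rewrite fubini_tonelli1//; apply: eq_integral => x _.
  rewrite /fubini_F fubini_tonelli1//.
  by apply: measurableT_comp => //; exact: pair1_measurable.
- exact: measurable_id.
- exact: iid3_law.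
Qed.

End iid_law.

Section edge_covariance.
Context (R : realType) (d d' dV : measure_display).
Context (Omega : measurableType d) (Omega' : measurableType d').
Context (V : measurableType dV).
Context (P : probability Omega R) (Q : probability Omega' R).

(* An expectation that is not defined is infinite, so its [fine] is [0]: no
   integrability is needed. *)
Lemma skew_expectation_eq0 (f : V -> V -> R) (X Y : {RV Q >-> V}) :
  measurable_fun [set: V * V] (fun z => f z.1 z.2) ->
  (forall x y, f y x = - f x y) ->
  identically_distributed X Y ->
  (forall A B, measurable A -> measurable B ->
    Q (X @^-1` A `&` Y @^-1` B) = (Q (X @^-1` A) * Q (Y @^-1` B))%E) ->
  fine 'E_Q[fun w => f (X w) (Y w)] = 0.
Proof.
move=> mf skew XY ind; rewrite unlock.
have mX := @measurable_funPT _ _ _ _ X.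
have mY := @measurable_funPT _ _ _ _ Y.
have E : (\int[Q]_w (f (X w) (Y w))%:E = \int[Q]_w (f (Y w) (X w))%:E)%E.
  apply: (@integral_same_law _ _ _ _ _ _ _ Q Q (fun w => (X w, Y w))
    (fun w => (Y w, X w)) (fun z => (f z.1 z.2)%:E)).
  - exact: measurable_fun_pair.
  - exact: measurable_fun_pair.
  - move=> A mA.
    pose mu : probability V R := distribution Q X.
    rewrite (@scaled_product_law _ _ _ _ _ _ _ Q mu mu 1 X Y)//; last first.
      move=> B C mB mC; rewrite mul1e.
      transitivity (Q (X @^-1` B) * Q (Y @^-1` C))%E; first exact: ind.
      congr (_ * _)%E.
      exact/esym/XY.
    rewrite (@scaled_product_law _ _ _ _ _ _ _ Q mu mu 1 Y X)//.
    move=> B C mB mC; rewrite mul1e muleC.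
    transitivity (Q (X @^-1` C `&` Y @^-1` B)); first by rewrite setIC.
    transitivity (Q (X @^-1` C) * Q (Y @^-1` B))%E; first exact: ind.
    congr (_ * _)%E.
    exact/esym/XY.
  - exact/measurable_EFinP.
(* Negation exchanges positive and negative parts, so exchangeability reads a - b = b - a in the
   extended reals: either both are finite and a - b = 0, or the difference is infinite and [fine]
   sends it to 0. *)
have NE : (\int[Q]_w (f (Y w) (X w))%:E =
    \int[Q]_w (EFin \o (fun w => f (X w) (Y w)))^\- w -
    \int[Q]_w (EFin \o (fun w => f (X w) (Y w)))^\+ w)%E.
  rewrite integralE; congr (_ - _)%E; apply: eq_integral => w _.
    by rewrite !unlock /= skew EFinN.
  by rewrite !unlock /= skew opprK.
move: E; rewrite NE integralE.
set a := (\int[Q]_w _^\+ _)%E; set b := (\int[Q]_w _^\- _)%E.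
case: a => [a| |]; case: b => [b| |] //=.
by rewrite -!EFinD => -[] ?; lra.
Qed.

Variables (F : Omega -> V -> V -> R) (X Y W : {RV Q >-> V}).
Hypothesis mF : measurable_fun [set: Omega * (V * V)] (fun z => F z.1 z.2.1 z.2.2).
Hypothesis skewF : forall w x y, F w y x = - F w x y.
Variable c : V * V -> V * V -> R.
Hypothesis FE : forall p q : V * V,
  integral_is P (fun w => F w p.1 p.2 * F w q.1 q.2) (c p q).
Variable K : R.
Hypothesis cK : forall p, c p p <= K.

(** Integrability on the product space comes from |p q| <= p^2 + q^2: for fixed endpoints the P-mean
    is at most the sum of two diagonal values of [c], hence at most [K + K]. *)
Lemma covariance_Fubini (Z1 Z2 : Omega' -> V * V) :
  measurable_fun [set: Omega'] Z1 -> measurable_fun [set: Omega'] Z2 ->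
  (\int[P]_w \int[Q]_w' (F w (Z1 w').1 (Z1 w').2 * F w (Z2 w').1 (Z2 w').2)%:E =
   \int[Q]_w' (c (Z1 w') (Z2 w'))%:E)%E.
Proof.
move=> mZ1 mZ2.
pose f (z : Omega * Omega') : \bar R :=
  (F z.1 (Z1 z.2).1 (Z1 z.2).2 * F z.1 (Z2 z.2).1 (Z2 z.2).2)%:E.
have mFZ (Z : Omega' -> V * V) : measurable_fun setT Z ->
    measurable_fun [set: Omega * Omega'] (fun z => F z.1 (Z z.2).1 (Z z.2).2).
  move=> mZ; apply: (@measurableT_comp _ _ _ _ _ _
    (fun z : Omega * (V * V) => F z.1 z.2.1 z.2.2) _ (fun z => (z.1, Z z.2))) => //.
  by apply: measurable_fun_pair => //; exact: measurableT_comp.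
have mf : measurable_fun [set: Omega * Omega'] f.
  by apply/measurable_EFinP; apply: measurable_funM; exact: mFZ.
have intf : (P \x Q)%E.-integrable setT f.
  apply/integrable21ltyP => //.
  apply: (@le_lt_trans _ _ (\int[Q]_w' (K + K)%:E)%E); last first.
    by rewrite integral_cst//= probability_setT mule1 ltry.
  apply: ge0_le_integral => //.
  - by move=> y _; exact: integral_ge0.
  - apply: (measurable_fun_fubini_tonelli_G (abse \o f)) => //=.
    exact: measurableT_comp.
  - move=> y _.
    have [[i1 E1] [i2 E2]] := (FE (Z1 y) (Z1 y), FE (Z2 y) (Z2 y)).
    apply: (@le_trans _ _ (c (Z1 y) (Z1 y) + c (Z2 y) (Z2 y))%:E); last first.
      by rewrite lee_fin lerD.
    have [i3 <-] := integral_isD (FE (Z1 y) (Z1 y)) (FE (Z2 y) (Z2 y)).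
    apply: ge0_le_integral => //.
    + apply: measurableT_comp => //.
      by apply: measurableT_comp mf _; exact: pair2_measurable.
    + by have /measurable_int := i3.
    + move=> w _; rewrite /f /= lee_fin ler_norml.
      set p := F _ _ _; set q := F _ _ _.
      have := sqr_ge0 (p + q); have := sqr_ge0 (p - q).
      have := sqr_ge0 p; have := sqr_ge0 q; rewrite !expr2 => ? ? ? ?.
      by apply/andP; split; nra.
rewrite [LHS](Fubini intf); apply: eq_integral => w' _.
by have [_] := FE (Z1 w') (Z2 w').
Qed.

Hypothesis XYW : iid3 X Y W.

Let indXY A B : measurable A -> measurable B ->
  Q (X @^-1` A `&` Y @^-1` B) = (Q (X @^-1` A) * Q (Y @^-1` B))%E.
Proof.
move=> mA mB; have [_ _ ind] := XYW; have := ind A B setT mA mB measurableT.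
by rewrite preimage_setT setIT probability_setT mule1.
Qed.

Let indXW A B : measurable A -> measurable B ->
  Q (X @^-1` A `&` W @^-1` B) = (Q (X @^-1` A) * Q (W @^-1` B))%E.
Proof.
move=> mA mB; have [_ _ ind] := XYW; have := ind A setT B mA measurableT mB.
by rewrite preimage_setT setIT probability_setT mule1.
Qed.

Let mFw w : measurable_fun [set: V * V] (fun z => F w z.1 z.2).
Proof.
apply: (@measurableT_comp _ _ _ _ _ _ (fun z : Omega * (V * V) =>
  F z.1 z.2.1 z.2.2) _ (fun z => (w, z))) => //.
exact: pair1_measurable.
Qed.

Let EXY w : fine 'E_Q[fun w' => F w (X w') (Y w')] = 0.
Proof.
apply: skew_expectation_eq0; [exact: mFw|exact: skewF|by case: XYW|exact: indXY].
Qed.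

Let EXW w : fine 'E_Q[fun w' => F w (X w') (W w')] = 0.
Proof.
apply: skew_expectation_eq0; [exact: mFw|exact: skewF|by case: XYW|exact: indXW].
Qed.

(** The variance subtracts the [fine] of the conditional mean, which is 0 for every [w] by [EXY], so
    only the mean square is left. *)
Lemma edge_varianceE :
  edge_variance P F X Y = (\int[Q]_w (c (X w, Y w) (X w, Y w))%:E)%E.
Proof.
rewrite -(@covariance_Fubini (fun w => (X w, Y w)) (fun w => (X w, Y w))).
- apply: eq_integral => w _; rewrite /variance unlock EXY unlock.
  apply: eq_integral => w' _ /=; congr EFin.
  transitivity ((F w (X w') (Y w') - 0) * (F w (X w') (Y w') - 0)) => //.
  by rewrite !subr0.
- exact: measurable_fun_pair.
- exact: measurable_fun_pair.
Qed.

Lemma shared_endpoint_covarianceE :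
  shared_endpoint_covariance P F X Y W =
  (\int[Q]_w (c (X w, Y w) (X w, W w))%:E)%E.
Proof.
rewrite -(@covariance_Fubini (fun w => (X w, Y w)) (fun w => (X w, W w))).
- apply: eq_integral => w _; rewrite unlock EXY EXW unlock.
  apply: eq_integral => w' _ /=; congr EFin.
  transitivity ((F w (X w') (Y w') - 0) * (F w (X w') (W w') - 0)) => //.
  by rewrite !subr0.
- exact: measurable_fun_pair.
- exact: measurable_fun_pair.
Qed.

End edge_covariance.

(** * Gaussian kernels of isotropic normal vectors *)

Definition sq_dist (R : realType) n (x y : n.-tuple R) : R :=
  \sum_(i < n) (tnth x i - tnth y i) ^+ 2.

Definition rbf (R : realType) n (s : R) (x y : n.-tuple R) : R :=
  expR (- (s / 2) * sq_dist x y).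

Section rbf.
Context (R : realType) (n : nat).
Implicit Types (s : R) (x y : n.-tuple R).

Lemma sq_distC x y : sq_dist x y = sq_dist y x.
Proof. by apply: eq_bigr => i _; rewrite -sqrrN opprB. Qed.

Lemma rbfC s x y : rbf s x y = rbf s y x.
Proof. by rewrite /rbf sq_distC. Qed.

Lemma rbfxx s x : rbf s x x = 1.
Proof.
by rewrite /rbf /sq_dist big1 ?mulr0 ?expR0// => i _; rewrite subrr expr0n.
Qed.

Lemma rbf_prod s x y :
  rbf s x y = \prod_(i < n) expR (- (s / 2) * (tnth x i - tnth y i) ^+ 2).
Proof. by rewrite /rbf /sq_dist mulr_sumr expR_sum. Qed.

Lemma rbf_ge0 s x y : 0 <= rbf s x y. Proof. exact: expR_ge0. Qed.

Lemma measurable_rbf s :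
  measurable_fun [set: n.-tuple R * n.-tuple R] (fun z => rbf s z.1 z.2).
Proof.
apply: measurableT_comp => //; apply: measurable_funM => //.
apply: measurable_sum => i; apply: measurable_funX; apply: measurable_funB.
- apply: (@measurableT_comp _ _ _ _ _ _ ((@tnth n R)^~ i) _ fst) => //.
  exact: measurable_tnth.
- apply: (@measurableT_comp _ _ _ _ _ _ ((@tnth n R)^~ i) _ snd) => //.
  exact: measurable_tnth.
Qed.

End rbf.

Section isqrt1p.
Context (R : realType).
Implicit Types s t : R.

Lemma isqrt1p_ge0 s : 0 <= isqrt1p s.
Proof. by rewrite invr_ge0 sqrtr_ge0. Qed.

(** From (1 + s) (1 + t / (1 + s)) = 1 + s + t. It merges the factors left by two successive
    Gaussian integrations. *)
Lemma isqrt1pM s t : 0 <= s -> 0 <= t ->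
  isqrt1p s * isqrt1p (t / (1 + s)) = isqrt1p (s + t).
Proof.
move=> s0 t0; rewrite /isqrt1p -invfM -sqrtrM; last lra.
by congr (Num.sqrt _)^-1; field; rewrite gt_eqF//; lra.
Qed.

Lemma isqrt1p_sqr s : 0 <= s -> isqrt1p s ^+ 2 = (1 + s)^-1.
Proof. by move=> s0; rewrite exprVn sqr_sqrtr//; lra. Qed.

End isqrt1p.

Section std_normal_gauss.
Variables (R : realType) (n : nat) (nu : probability (n.-tuple R) R).
Hypothesis nuE : std_normal_law nu.

Lemma std_normal_gauss_prod (C s : R) : 0 <= C -> 0 <= s ->
  (\int[nu]_z (\prod_(i < n) (C * expR (- (s / 2) * tnth z i ^+ 2)))%:E =
   ((C * isqrt1p s) ^+ n)%:E)%E.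
Proof.
move=> C0 s0.
rewrite (integral_std_normal_prod nuE
  (f := fun _ x => C * expR (- (s / 2) * x ^+ 2))
  (v := fun=> C * isqrt1p s)).
- by rewrite prodr_const card_ord.
- move=> _; apply: measurable_funM => //; apply: measurableT_comp => //.
  exact: measurable_funM.
- by move=> _ x; rewrite mulr_ge0 ?expR_ge0.
- move=> _; have [int E] := integral_isZ C (normal_prob_gauss 0 s0).
  move: E; rewrite expr0n/= mulr0 expR0 mulr1 -/(isqrt1p s) => <-.
  by apply: eq_integral => x _; rewrite sub0r sqrrN.
Qed.

Lemma std_normal_rbf (s : R) (x : n.-tuple R) : 0 <= s ->
  (\int[nu]_z (rbf s x z)%:E =
   (\prod_(i < n)
      (isqrt1p s * expR (- (s / (1 + s) / 2) * tnth x i ^+ 2)))%:E)%E.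
Proof.
move=> s0; under eq_integral do rewrite rbf_prod.
rewrite (integral_std_normal_prod nuE
  (f := fun i c => expR (- (s / 2) * (tnth x i - c) ^+ 2))
  (v := fun i => isqrt1p s * expR (- (s / (1 + s) / 2) * tnth x i ^+ 2)))//.
- move=> i; apply: measurableT_comp => //; apply: measurable_funM => //.
  by apply: measurable_funX; exact: measurable_funB.
- move=> i; have [_ E] := normal_prob_gauss (tnth x i) s0.
  have -> : s / (1 + s) / 2 = s / (2 * (1 + s)) by field; rewrite gt_eqF//; lra.
  exact: E.
Qed.

End std_normal_gauss.

Section isotropic_normal.
Variables (R : realType) (n : nat) (mu : probability (n.-tuple R) R).
Variables (m : 'cV[R]_n) (sigma : R).
Hypothesis sigma0 : 0 < sigma.
Hypothesis muE : multivariate_normal_law m (sigma ^+ 2)%:M mu.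

(** The matrix A need not be [sigma] times the identity. Being square, it satisfies A^T A = sigma^2
    I along with A A^T = sigma^2 I, so z |-> m + A z is a similarity of ratio [sigma]. Moments of
    [rbf c] therefore depend on [c] and [sigma] only through [c * sigma ^+ 2]. *)
Lemma isotropic_normal_standardize :
  exists nu : probability (n.-tuple R) R, exists phi : n.-tuple R -> n.-tuple R,
    [/\ std_normal_law nu, measurable_fun setT phi,
        forall x y, sq_dist (phi x) (phi y) = sigma ^+ 2 * sq_dist x y &
        forall B, measurable B -> mu B = nu (phi @^-1` B)].
Proof.
have [nu [A [nuE AA muA]]] := muE.
exists nu, (fun z => tuple_of_col (m + A *m col_of_tuple z)); split => //.
  exact: measurable_affine.
have sdE (v w : n.-tuple R) : sq_dist v w =
    ((col_of_tuple v - col_of_tuple w)^T *m (col_of_tuple v - col_of_tuple w)) 0 0.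
  by rewrite mxE; apply: eq_bigr => i _; rewrite !mxE expr2.
have colK (v : 'cV[R]_n) : col_of_tuple (tuple_of_col v) = v.
  by apply/colP => i; rewrite mxE tnth_mktuple.
have AtA : A^T *m A = (sigma ^+ 2)%:M.
  have s2 : sigma ^+ 2 != 0 by rewrite expf_neq0// gt_eqF.
  have : A *m (sigma ^- 2 *: A^T) = 1%:M.
    by rewrite -scalemxAr AA scale_scalar_mx mulVf.
  move/mulmx1C; rewrite -scalemxAl => /(congr1 (fun M => sigma ^+ 2 *: M)).
  by rewrite scalerA divff// scale1r => ->; rewrite scale_scalar_mx mulr1.
move=> x y; rewrite !sdE !colK opprD addrACA subrr add0r -mulmxBr.
rewrite trmx_mul -mulmxA (mulmxA A^T) AtA mul_scalar_mx -scalemxAr mxE.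
by congr (_ * _); rewrite !mxE.
Qed.

Section rbf_moments.
Variable c : R.
Hypothesis c0 : 0 <= c.
Local Notation r2 := (c * sigma ^+ 2).

Let r20 : 0 <= r2. Proof. by rewrite mulr_ge0// sqr_ge0. Qed.

Let ge0_integral_standardize (nu : probability (n.-tuple R) R) phi f :
  measurable_fun setT phi ->
  (forall B, measurable B -> mu B = nu (phi @^-1` B)) ->
  measurable_fun [set: n.-tuple R] f -> (forall x, 0 <= f x)%E ->
  (\int[mu]_x f x = \int[nu]_x f (phi x))%E.
Proof.
move=> mphi muphi mf f0.
apply: (@ge0_integral_same_law _ _ _ _ _ _ _ mu nu idfun phi f) => //.
exact: measurable_id.
Qed.

Let rbf_phi (phi : n.-tuple R -> n.-tuple R) :
  (forall x y, sq_dist (phi x) (phi y) = sigma ^+ 2 * sq_dist x y) ->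
  forall x y : n.-tuple R, rbf c (phi x) (phi y) = rbf r2 x y.
Proof. by move=> dphi x y; rewrite /rbf dphi; congr expR; ring. Qed.

Let integral_rbf (nu : probability (n.-tuple R) R)
    (phi : n.-tuple R -> n.-tuple R) :
  std_normal_law nu -> measurable_fun setT phi ->
  (forall x y, sq_dist (phi x) (phi y) = sigma ^+ 2 * sq_dist x y) ->
  (forall B, measurable B -> mu B = nu (phi @^-1` B)) ->
  forall x, (\int[mu]_y (rbf c (phi x) y)%:E =
   (\prod_(i < n)
      (isqrt1p r2 * expR (- (r2 / (1 + r2) / 2) * tnth x i ^+ 2)))%:E)%E.
Proof.
move=> nuE mphi dphi muphi x.
rewrite (ge0_integral_standardize mphi muphi).
- under eq_integral do rewrite rbf_phi//.
  exact: std_normal_rbf.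
- apply/measurable_EFinP.
  apply: (@measurableT_comp _ _ _ _ _ _ (fun z => rbf c z.1 z.2) _ (pair (phi x))).
    exact: measurable_rbf.
  exact: pair1_measurable.
- by move=> y; rewrite lee_fin rbf_ge0.
Qed.

Let measurable_rbf1 x : measurable_fun [set: n.-tuple R] (rbf c x).
Proof.
apply: (@measurableT_comp _ _ _ _ _ _ (fun z => rbf c z.1 z.2) _ (pair x)).
  exact: measurable_rbf.
exact: pair1_measurable.
Qed.

(** The argument 2 [r2] reflects that X - Y has covariance 2 sigma^2 I. Per coordinate, the inner
    integral leaves a Gaussian of precision r2 / (1 + r2), and [isqrt1pM] joins the two factors. *)
Lemma isotropic_normal_rbf2 :
  (\int[mu]_x \int[mu]_y (rbf c x y)%:E = ((isqrt1p (2 * r2)) ^+ n)%:E)%E.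
Proof.
have [nu [phi [nuE mphi dphi muphi]]] := isotropic_normal_standardize.
rewrite (ge0_integral_standardize mphi muphi).
- under eq_integral do rewrite (integral_rbf nuE mphi dphi muphi).
  rewrite (std_normal_gauss_prod nuE) ?isqrt1p_ge0 ?divr_ge0 ?addr_ge0//.
  by rewrite isqrt1pM//; congr (isqrt1p _ ^+ _)%:E; ring.
- apply: (measurable_fun_fubini_tonelli_F (fun z => (rbf c z.1 z.2)%:E)) => //.
    by apply/measurable_EFinP; exact: measurable_rbf.
  by move=> z; rewrite lee_fin rbf_ge0.
- by move=> x; apply: integral_ge0 => y _; rewrite lee_fin rbf_ge0.
Qed.

(** Given x, the two kernels are independent with the same mean [G x], so the integral is that of
    [G ^ 2]. Squaring doubles the precision left by the inner integral, whence r2 + 2 r2 = 3 r2. *)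
Lemma isotropic_normal_rbf3 :
  (\int[mu]_x \int[mu]_y \int[mu]_z (rbf c x z * rbf c x y)%:E =
   ((isqrt1p r2 * isqrt1p (3 * r2)) ^+ n)%:E)%E.
Proof.
have [nu [phi [nuE mphi dphi muphi]]] := isotropic_normal_standardize.
pose G x := (\int[mu]_y (rbf c x y)%:E)%E.
have G0 x : (0 <= G x)%E by apply: integral_ge0 => y _; rewrite lee_fin rbf_ge0.
have mG : measurable_fun [set: n.-tuple R] G.
  apply: (measurable_fun_fubini_tonelli_F (fun z => (rbf c z.1 z.2)%:E)) => //.
    by apply/measurable_EFinP; exact: measurable_rbf.
  by move=> z; rewrite lee_fin rbf_ge0.
transitivity (\int[mu]_x (G x * G x))%E.
  apply: eq_integral => x _; rewrite -ge0_integralZl//.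
  - apply: eq_integral => y _; under eq_integral do rewrite EFinM.
    rewrite ge0_integralZr//.
    + by apply/measurable_EFinP; exact: measurable_rbf1.
    + by move=> z _; rewrite lee_fin rbf_ge0.
    + by rewrite lee_fin rbf_ge0.
  - by apply/measurable_EFinP; exact: measurable_rbf1.
  - by move=> z _; rewrite lee_fin rbf_ge0.
rewrite (ge0_integral_standardize mphi muphi).
- under eq_integral => x _.
    rewrite /G (integral_rbf nuE mphi dphi muphi) -EFinM -big_split/=.
    under eq_bigr => i _.
      rewrite mulrACA -expRD -expr2 isqrt1p_sqr// -mulrDl -opprD -mulrDl.
      over.
    over.
  have q0 : 0 <= r2 / (1 + r2) by rewrite divr_ge0 ?addr_ge0.
  rewrite (std_normal_gauss_prod nuE); last 2 first.
  + by rewrite invr_ge0 addr_ge0.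
  + exact: addr_ge0.
  have -> : isqrt1p (3 * r2) = isqrt1p r2 * isqrt1p ((r2 + r2) / (1 + r2)).
    by rewrite isqrt1pM ?addr_ge0//; congr isqrt1p; ring.
  by rewrite mulrA -expr2 isqrt1p_sqr// -mulrDl.
- exact: emeasurable_funM.
- by move=> x; rewrite mule_ge0.
Qed.

End rbf_moments.

End isotropic_normal.

(** * Second-order expansions at the origin *)

Section expansion.
Variable R : realType.
Implicit Types (f g h : R -> R).

Definition bounded01 h := exists C, forall x, 0 <= x <= 1 -> `|h x| <= C.

Lemma bounded01_cst (a : R) : bounded01 (fun=> a).
Proof. by exists `|a|. Qed.

Lemma bounded01_id : bounded01 id.
Proof. by exists 1 => x /andP[x0 x1]; rewrite ger0_norm. Qed.

Lemma bounded01D f g : bounded01 f -> bounded01 g -> bounded01 (fun x => f x + g x).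
Proof.
move=> [C fC] [D gD]; exists (C + D) => x x01.
by rewrite (le_trans (ler_normD _ _))// lerD ?fC ?gD.
Qed.

Lemma bounded01M f g : bounded01 f -> bounded01 g -> bounded01 (fun x => f x * g x).
Proof.
move=> [C fC] [D gD]; exists (C * D) => x x01.
by rewrite normrM ler_pM ?fC ?gD.
Qed.

(** The explicit remainder turns each rule of calculation into a ring identity together with the
    boundedness of a new [h]. *)
Definition expansion2 f a b c := exists2 h, bounded01 h &
  forall x, 0 <= x <= 1 -> f x = a + b * x + c * x ^+ 2 + x ^+ 3 * h x.

Lemma expansion2_poly a b c : expansion2 (fun x => a + b * x + c * x ^+ 2) a b c.
Proof.
exists (fun=> 0); first exact: bounded01_cst.
by move=> x _; rewrite mulr0 addr0.
Qed.

Lemma expansion2B f g a b c a' b' c' :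
  expansion2 f a b c -> expansion2 g a' b' c' ->
  expansion2 (fun x => f x - g x) (a - a') (b - b') (c - c').
Proof.
move=> [h bh fE] [h' bh' gE]; exists (fun x => h x + (- 1) * h' x).
  by apply: bounded01D => //; apply: bounded01M => //; exact: bounded01_cst.
by move=> x x01; rewrite fE// gE//; ring.
Qed.

Lemma expansion2M f g a b c a' b' c' :
  expansion2 f a b c -> expansion2 g a' b' c' ->
  expansion2 (fun x => f x * g x) (a * a') (a * b' + b * a')
    (a * c' + b * b' + c * a').
Proof.
move=> [h bh fE] [h' bh' gE].
(* All terms of degree at least 3, divided by x^3. Powers are spelled as products so that closure
   under + and * proves boundedness. *)
pose k x := b * c' + c * b' + c * c' * x + (a + b * x + c * (x * x)) * h' x +
  (a' + b' * x + c' * (x * x)) * h x + x * x * x * h x * h' x.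
exists k; last by move=> x x01; rewrite fE// gE// /k; ring.
rewrite /k.
by do ![apply: bounded01D | apply: bounded01M | exact: bounded01_id |
  exact: bounded01_cst | exact: bh | exact: bh'].
Qed.

Lemma expansion2X f b c n : expansion2 f 1 b c ->
  expansion2 (fun x => f x ^+ n) 1 (n%:R * b)
    (n%:R * c + n%:R * (n%:R - 1) / 2 * b ^+ 2).
Proof.
move=> fE; elim: n => [|n IH].
  have := expansion2_poly 1 0 0; congr expansion2.
  - by apply/funext => x; rewrite expr0 !mul0r !addr0.
  - by rewrite mul0r.
  - by rewrite !mul0r addr0.
have := expansion2M fE IH; congr expansion2.
- by apply/funext => x; rewrite exprS.
- by rewrite mulr1.
- by rewrite -natr1; ring.
- by rewrite -natr1; field.
Qed.

(** With s = sqrt(1 + u) and Taylor polynomial p, 1/s - p = (1 - p^2 s^2) / (s (1 + p s)), and 1 -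
    p^2 (1 + u) = - u^3 q(u) exactly. The factor [w] is at most 1 because s >= 1 and p >= 0. *)
Lemma isqrt1p_expansion2 (k : R) : 0 <= k ->
  expansion2 (fun x => isqrt1p (k * x)) 1 (- (k / 2)) (3 / 8 * k ^+ 2).
Proof.
move=> k0.
pose p u : R := 1 - u / 2 + 3 / 8 * u ^+ 2.
pose q (u : R) : R := 5 / 8 + - (15 / 64) * u + 9 / 64 * (u * u).
pose w x := isqrt1p (k * x) / (1 + p (k * x) * Num.sqrt (1 + k * x)).
exists (fun x => - (k ^+ 3) * q (k * x) * w x).
  apply: bounded01M.
    by rewrite /q; do ![apply: bounded01D | apply: bounded01M |
      exact: bounded01_id | exact: bounded01_cst].
  exists 1 => x /andP[x0 x1]; have u0 : 0 <= k * x by rewrite mulr_ge0.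
  rewrite /w /isqrt1p; set s := Num.sqrt _.
  have s1 : 1 <= s by rewrite -[leLHS]sqrtr1 /s ler_sqrt; lra.
  (* Indeed p(u) = 3/8 (u - 2/3)^2 + 5/6. *)
  have p0 : 0 <= p (k * x).
    by rewrite /p; have := sqr_ge0 (k * x - 2 / 3); rewrite !expr2; lra.
  have t1 : 1 <= 1 + p (k * x) * s by rewrite lerDl mulr_ge0//; lra.
  rewrite -invfM ger0_norm; last by rewrite invr_ge0 mulr_ge0; lra.
  by rewrite invf_le1; [nra | nra].
move=> x /andP[x0 x1]; have u0 : 0 <= k * x by rewrite mulr_ge0.
rewrite /w /isqrt1p; set s := Num.sqrt _.
have s1 : 1 <= s by rewrite -[leLHS]sqrtr1 /s ler_sqrt; lra.
have s2 : s ^+ 2 = 1 + k * x by rewrite sqr_sqrtr; lra.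
have p0 : 0 <= p (k * x).
  by rewrite /p; have := sqr_ge0 (k * x - 2 / 3); rewrite !expr2; lra.
have t0 : 1 + p (k * x) * s != 0.
  by rewrite gt_eqF// ltr_pwDl// mulr_ge0//; lra.
have s0 : s != 0 by rewrite gt_eqF//; lra.
set u := k * x in u0 s2 p0 t0 *.
have -> : 1 + - (k / 2) * x + 3 / 8 * k ^+ 2 * x ^+ 2 = p u by rewrite /p /u; field.
have -> : x ^+ 3 * (- k ^+ 3 * q u * (s^-1 / (1 + p u * s))) =
    - u ^+ 3 * q u / (s * (1 + p u * s)).
  have -> : u ^+ 3 = k ^+ 3 * x ^+ 3 by rewrite /u; ring.
  by field; rewrite ?s0 ?t0.
have -> : - u ^+ 3 * q u = 1 - p u ^+ 2 * s ^+ 2 by rewrite s2 /p /q; field.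
by field; rewrite ?s0 ?t0.
Qed.


Variable T : nat.
Hypothesis hT : (1 <= T)%N.

Definition endpoint_num (x : R) : R :=
  isqrt1p (2 * x) ^+ T - (isqrt1p x * isqrt1p (3 * x)) ^+ T.

Definition endpoint_den (x : R) : R := 1 - isqrt1p (4 * x) ^+ T.

(** A number in [0,1] can only decrease when raised to the power T >= 1, so T = 1 is the worst case;
    there the denominator is at least 2 x / (1 + 4 x), and 1 + 4 x <= 5. *)
Lemma endpoint_den_ge x : 0 < x <= 1 -> 2 / 5 * x <= endpoint_den x.
Proof.
move=> /andP[x0 x1].
have x40 : 0 < 4 * x by rewrite mulr_gt0.
have /andP[lb ub] := one_minus_isqrt1p_bounds x40.
have i0 : 0 <= isqrt1p (4 * x) by rewrite invr_ge0 sqrtr_ge0.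
have i1 : isqrt1p (4 * x) <= 1.
  by rewrite -subr_ge0 (le_trans _ lb)// divr_ge0//; lra.
have iT : isqrt1p (4 * x) ^+ T <= isqrt1p (4 * x).
  by rewrite -[leRHS]expr1 ler_wiXn2l.
apply: (@le_trans _ _ (4 * x / (2 * (1 + 4 * x)))).
  by rewrite ler_pdivlMr; nra.
by rewrite /endpoint_den; lra.
Qed.

(** Cross-multiplied, so that no expansion is ever divided. Up to O(x^3) the numerator is T x - 3 T
    (T + 1) / 2 x^2 and the denominator 2 T x - 2 T (T + 2) x^2; the slope - (T - 1) / 2 is (T + 2)
    - 3 (T + 1) / 2. *)
Lemma endpoint_expansion : expansion2
  (fun x => 2 * endpoint_num x - endpoint_den x * (1 - (T%:R - 1) / 2 * x)) 0 0 0.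
Proof.
have e1 := isqrt1p_expansion2 ler01.
have e2 := isqrt1p_expansion2 (ler0n R 2).
have e3 := isqrt1p_expansion2 (ler0n R 3).
have e4 := isqrt1p_expansion2 (ler0n R 4).
have num := expansion2B (expansion2X T e2)
  (expansion2M (expansion2X T e1) (expansion2X T e3)).
have den := expansion2B (expansion2_poly 1 0 0) (expansion2X T e4).
have := expansion2B (expansion2M (expansion2_poly 2 0 0) num)
  (expansion2M den (expansion2_poly 1 (- ((T%:R - 1) / 2)) 0)).
congr expansion2.
- apply/funext => x; rewrite /endpoint_num /endpoint_den exprMn mul1r.
  by rewrite !mul0r !addr0 mulNr.
- by field.
- by field.
- by field.
Qed.

Lemma endpoint_ratio_bound : exists2 C, 0 < C & forall x, 0 < x <= 1 ->
  `|2 * (endpoint_num x / endpoint_den x) - (1 - (T%:R - 1) / 2 * x)| <= C * x ^+ 2.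
Proof.
have [h [C hC] hE] := endpoint_expansion.
(* The factor 5/2 inverts the 2/5 of [endpoint_den_ge]; the added 1 keeps the constant positive. *)
exists (5 / 2 * (`|C| + 1)) => [|x /andP[x0 x1]].
  by rewrite mulr_gt0 ?divr_gt0// ltr_wpDl.
have x01 : 0 <= x <= 1 by rewrite x1 ltW.
have D0 : 2 / 5 * x <= endpoint_den x by rewrite endpoint_den_ge ?x0.
have Dp : 0 < endpoint_den x by rewrite (lt_le_trans _ D0)// mulr_gt0// divr_gt0.
have -> : 2 * (endpoint_num x / endpoint_den x) - (1 - (T%:R - 1) / 2 * x) =
    x ^+ 3 * h x / endpoint_den x.
  have := hE x x01; rewrite !mul0r !add0r => <-.
  by field; rewrite gt_eqF.
rewrite normrM normrV ?unitfE ?gt_eqF// (gtr0_norm Dp) ler_pdivrMr//.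
rewrite normrM (ger0_norm (exprn_ge0 _ (ltW x0))).
have hb : `|h x| <= `|C| + 1.
  by rewrite (le_trans (hC _ x01))// (le_trans (ler_norm _))// lerDl.
apply: (@le_trans _ _ (x ^+ 3 * (`|C| + 1))).
  by rewrite ler_wpM2l// exprn_ge0// ltW.
have -> : x ^+ 3 * (`|C| + 1) = 5 / 2 * (`|C| + 1) * x ^+ 2 * (2 / 5 * x) by field.
by rewrite ler_wpM2l// mulr_ge0 ?sqr_ge0// mulr_ge0 ?addr_ge0// divr_ge0.
Qed.

End expansion.

(** * Closed form of the correlation and its limit *)

Lemma quad_form_scalar (R : realType) n (c : R) (x y : n.-tuple R) :
  quad_form c%:M (col_of_tuple x - col_of_tuple y) = c * sq_dist x y.
Proof.
rewrite /quad_form mul_mx_scalar -scalemxAl mxE; congr (_ * _).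
by rewrite mxE; apply: eq_bigr => i _; rewrite !mxE expr2.
Qed.

Lemma k_u_isotropic (R : realType) n (sigma_u c : R) (Su : 'M[R]_n) p q :
  invmx Su = c%:M ->
  k_u sigma_u Su p q = sigma_u ^+ 2 * (rbf c p.1 q.1 * rbf c p.2 q.2).
Proof.
move=> SuE; rewrite /k_u SuE !quad_form_scalar -expRD; congr (_ * expR _).
by field.
Qed.

Lemma shared_endpoint_correlation_isotropic (R : realType) (T : nat)
    (d d' : measure_display) (Omega : measurableType d)
    (Omega' : measurableType d') (P : probability Omega R)
    (Q : probability Omega' R) (U : Omega -> T.-tuple R * T.-tuple R -> R)
    (X Y W : {RV Q >-> T.-tuple R}) (Su : 'M[R]_T) (mu_x : 'cV[R]_T)
    (sigma_u sigma_x c : R) :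
  0 < sigma_u -> 0 < sigma_x -> 0 < c -> invmx Su = c%:M ->
  gaussian_process P U (k_u sigma_u Su) ->
  measurable_fun [set: Omega * (T.-tuple R * T.-tuple R)] (fun z => U z.1 z.2) ->
  (forall x y, 'E_P[fun w => skew_part U w x y] = 0)%E ->
  iid3 X Y W ->
  multivariate_normal_law mu_x (sigma_x ^+ 2)%:M (distribution Q X) ->
  shared_endpoint_correlation P (skew_part U) X Y W =
  endpoint_num T (c * sigma_x ^+ 2) / endpoint_den T (c * sigma_x ^+ 2).
Proof.
move=> su0 sx0 c0 SuE UE mU U0 XYW XE.
set r2 := c * sigma_x ^+ 2.
pose F := skew_part U.
(* The four terms of [skew_gaussian_covariance] coincide in pairs, since reversing both edges at
   once leaves the kernel unchanged; hence the factor 2. *)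
pose cov (p q : T.-tuple R * T.-tuple R) : R :=
  2 * sigma_u ^+ 2 *
  (rbf c p.1 q.1 * rbf c p.2 q.2 - rbf c p.1 q.2 * rbf c p.2 q.1).
have mF : measurable_fun [set: Omega * (T.-tuple R * T.-tuple R)]
    (fun z => F z.1 z.2.1 z.2.2).
  apply: measurable_funB.
    rewrite (_ : (fun _ => _) =
      fun z : Omega * (T.-tuple R * T.-tuple R) => U z.1 z.2)//.
    by apply/funext => -[w [x y]].
  apply: (@measurableT_comp _ _ _ _ _ _ (fun z : Omega * (T.-tuple R * T.-tuple R) =>
    U z.1 z.2) _ (fun z => (z.1, (z.2.2, z.2.1)))) => //.
  apply: measurable_fun_pair => //.
  by apply: measurable_fun_pair => //; exact: measurableT_comp.
have skewF w x y : F w y x = - F w x y by rewrite /F /skew_part opprB.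
have FE p q : integral_is P (fun w => F w p.1 p.2 * F w q.1 q.2) (cov p q).
  have := skew_gaussian_covariance UE U0 p.1 p.2 q.1 q.2.
  by congr integral_is; rewrite !(k_u_isotropic _ _ _ SuE) /cov /=; ring.
have covK p : cov p p <= 2 * sigma_u ^+ 2.
  rewrite /cov !rbfxx mulr1 -[leRHS]mulr1.
  apply: ler_wpM2l; first by rewrite mulr_ge0 ?sqr_ge0.
  by rewrite gerBl mulr_ge0 ?rbf_ge0.
have varE := edge_varianceE mF skewF FE covK XYW.
have covE := shared_endpoint_covarianceE mF skewF FE covK XYW.
pose mu : probability (T.-tuple R) R := distribution Q X.
have muE : multivariate_normal_law mu_x (sigma_x ^+ 2)%:M mu := XE.
have iQ (h : T.-tuple R * (T.-tuple R * T.-tuple R) -> R) v :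
    measurable_fun setT h -> (forall z, 0 <= h z) ->
    (\int[mu]_x \int[mu]_y \int[mu]_z (h (x, (y, z)))%:E = v%:E)%E ->
    integral_is Q (fun w => h (X w, (Y w, W w))) v.
  move=> mh h0 hE; apply: ge0_integral_is => //.
    apply: (@measurableT_comp _ _ _ _ _ _ h _ (fun w => (X w, (Y w, W w)))) => //.
    by apply: measurable_fun_pair => //; exact: measurable_fun_pair.
  rewrite -hE; apply: (ge0_iid3_integral XYW (h := EFin \o h)) => //.
  exact/measurable_EFinP.
have cst1 (v : \bar R) : (\int[mu]_z v = v)%E.
  by rewrite integral_cst//= probability_setT mule1.
have mrbf s d1 (S : measurableType d1) (f g : S -> T.-tuple R) :
    measurable_fun setT f -> measurable_fun setT g ->
    measurable_fun setT (fun z => rbf s (f z) (g z)).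
  move=> mf mg; apply: (@measurableT_comp _ _ _ _ _ _
    (fun z => rbf s z.1 z.2) _ (fun z => (f z, g z))) => //.
    exact: measurable_rbf.
  exact: measurable_fun_pair.
pose V3 := (T.-tuple R * (T.-tuple R * T.-tuple R))%type.
have mp21 : measurable_fun [set: V3] (fun z => z.2.1) by exact: measurableT_comp.
have mp22 : measurable_fun [set: V3] (fun z => z.2.2) by exact: measurableT_comp.
have EYW : integral_is Q (fun w => rbf c (Y w) (W w)) (isqrt1p (2 * r2) ^+ T).
  apply: (iQ (fun z => rbf c z.2.1 z.2.2)).
  - exact: mrbf.
  - by move=> z; exact: rbf_ge0.
  - by rewrite /= cst1 (isotropic_normal_rbf2 sx0 muE (ltW c0)).
have EXY2 : integral_is Q (fun w => rbf c (X w) (Y w) ^+ 2) (isqrt1p (4 * r2) ^+ T).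
  apply: (iQ (fun z => rbf c z.1 z.2.1 ^+ 2)).
  - by apply: measurable_funX; exact: mrbf.
  - by move=> z; rewrite sqr_ge0.
  - under eq_integral => x _ do under eq_integral => y _ do rewrite /= cst1.
    (* The square of the kernel is the kernel with precision 2 c, whose two-point moment has
       argument 2 (2 r2) = 4 r2. *)
    have c20 : 0 <= 2 * c by rewrite mulr_ge0// ltW.
    have -> : 4 * r2 = 2 * (2 * c * sigma_x ^+ 2) by rewrite /r2; ring.
    rewrite -(isotropic_normal_rbf2 sx0 muE c20).
    apply: eq_integral => x _; apply: eq_integral => y _; congr EFin.
    by rewrite /rbf expr2 -expRD; congr expR; field.
have EXXX : integral_is Q (fun w => rbf c (X w) (W w) * rbf c (X w) (Y w))
    ((isqrt1p r2 * isqrt1p (3 * r2)) ^+ T).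
  apply: (iQ (fun z => rbf c z.1 z.2.2 * rbf c z.1 z.2.1)).
  - by apply: measurable_funM; exact: mrbf.
  - by move=> z; rewrite mulr_ge0 ?rbf_ge0.
  - exact: (isotropic_normal_rbf3 sx0 muE (ltW c0)).
have [_ varI] := integral_isZ (2 * sigma_u ^+ 2)
  (integral_isD (integral_is_cst Q 1) (integral_isZ (-1) EXY2)).
have [_ covI] := integral_isZ (2 * sigma_u ^+ 2)
  (integral_isD EYW (integral_isZ (-1) EXXX)).
have vE : edge_variance P F X Y = (2 * sigma_u ^+ 2 * endpoint_den T r2)%:E.
  rewrite varE /endpoint_den -[X in _ * (1 + X)]mulN1r -varI.
  apply: eq_integral => w _; congr EFin.
  by rewrite /cov/= !rbfxx (rbfC c (Y w) (X w)); ring.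
have cE : shared_endpoint_covariance P F X Y W =
    (2 * sigma_u ^+ 2 * endpoint_num T r2)%:E.
  rewrite covE /endpoint_num -[X in _ * (_ + X)]mulN1r -covI.
  apply: eq_integral => w _; congr EFin.
  by rewrite /cov/= !rbfxx (rbfC c (Y w) (X w)); ring.
rewrite /shared_endpoint_correlation vE cE /= invfM mulrACA mulVf ?mul1r 1?mulrC//.
by rewrite mulf_neq0// expf_neq0// gt_eqF.
Qed.

Theorem mainTheorem2 (R : realType) (T : nat) (hT : (1 <= T)%N) :
  exists rho : R -> R,
    [/\ (forall (d d' : measure_display)
           (Omega : measurableType d) (Omega' : measurableType d')
           (P : probability Omega R) (Q : probability Omega' R)
           (U : Omega -> T.-tuple R * T.-tuple R -> R)
           (X Y W : {RV Q >-> T.-tuple R})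
           (Sigma_u Sigma_x : 'M[R]_T) (mu_x : 'cV[R]_T)
           (sigma_u sigma_x r : R),
           0 < sigma_u -> 0 < sigma_x -> 0 < r ->
           sym_posdef Sigma_u ->
           gaussian_process P U (k_u sigma_u Sigma_u) ->
           measurable_fun [set: Omega * (T.-tuple R * T.-tuple R)]
             (fun z => U z.1 z.2) ->
           (forall x y, 'E_P[fun w => skew_part U w x y] = 0)%E ->
           iid3 X Y W ->
           Sigma_x = (sigma_x ^+ 2)%:M ->
           multivariate_normal_law mu_x Sigma_x (distribution Q X) ->
           invmx Sigma_u *m Sigma_x = (r ^+ 2)%:M ->
           shared_endpoint_correlation P (skew_part U) X Y W = rho r),
        (exists e : R -> R,
           e =O_ (0^'+) (fun r => r ^+ 4) /\
           forall r, 0 < r ->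
             rho r = 2^-1 * (1 - (T%:R - 1) / 2 * r ^+ 2 + e r)) &
        rho r @[r --> 0^'+] --> (2^-1 : R)].
Proof.
(* Fixed before any process is given, which expresses that the correlation depends only on r and T.
   With [e] defined as the exact error, the expansion is an identity and its content lies in the
   bound on [e]. *)
pose rho (r : R) := endpoint_num T (r ^+ 2) / endpoint_den T (r ^+ 2).
pose e (r : R) := 2 * rho r - (1 - (T%:R - 1) / 2 * r ^+ 2).
have [C C0 eC] := endpoint_ratio_bound R hT.
have near01 : \forall r \near (0 : R)^'+, 0 < r <= 1.
  near=> r; apply/andP; split => //.
  by near: r; exact: nbhs_right_le.
have eO : e =O_ (0^'+) (fun r => r ^+ 4).
  apply/eqO_exP; exists C => //; near=> r.
  have /andP[r0 r1] : 0 < r <= 1 by near: r.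
  rewrite [`|r ^+ 4|]ger0_norm; last by rewrite exprn_ge0// ltW.
  by rewrite (exprM r 2 2); apply: eC; rewrite exprn_gt0// exprn_ile1// ltW.
have rhoE r : rho r = 2^-1 * (1 - (T%:R - 1) / 2 * r ^+ 2 + e r).
  by rewrite /e addrC subrK mulKf.
exists rho; split.
- move=> d d' Omega Omega' P Q U X Y W Su Sx mu_x su sx r su0 sx0 r0 _ UE mU U0.
  move=> XYW -> XE SuSx.
  have sx20 : sx ^+ 2 != 0 by rewrite expf_neq0// gt_eqF.
  have SuE : invmx Su = (r ^+ 2 / sx ^+ 2)%:M.
    move: SuSx; rewrite mul_mx_scalar => /(congr1 (fun M => sx ^- 2 *: M)).
    by rewrite scalerA mulVf// scale1r scale_scalar_mx mulrC.
  rewrite (shared_endpoint_correlation_isotropic su0 sx0 _ SuE UE mU U0 XYW XE).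
    by rewrite divfK.
  by rewrite divr_gt0// exprn_gt0.
- by exists e; split.
(* For 0 < r <= 1, |e r| <= C r^4 <= C r^2, so |1/2 - rho r| <= M r^2. *)
- pose M := `|(T%:R - 1) / 2 : R| + C.
  have M0 : 0 < M by rewrite ltr_wpDl.
  have sqr0 : M * r ^+ 2 @[r --> (0 : R)^'+] --> (0 : R).
    apply: cvg_at_right_filter.
    rewrite -[X in _ --> X](mulr0 M) -[X in _ --> M * X](expr0n R 2).
    by apply: cvgM; [exact: cvg_cst | exact: sqr_continuous].
  apply/cvgrPdist_le => eps eps0; near=> r.
  have /andP[r0 r1] : 0 < r <= 1 by near: r.
  have r21 : 0 < r ^+ 2 <= 1 by rewrite exprn_gt0// exprn_ile1// ltW.
  have small : `|0 - M * r ^+ 2| <= eps.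
    by near: r; move/cvgrPdist_le : sqr0; exact.
  move: small; rewrite sub0r normrN ger0_norm ?mulr_ge0 ?sqr_ge0 ?(ltW M0)//.
  apply: le_trans; have := eC _ r21; rewrite -/(rho r) -/(e r) => er.
  have -> : 2^-1 - rho r = 2^-1 * ((T%:R - 1) / 2 * r ^+ 2 - e r).
    by rewrite rhoE; field.
  rewrite normrM gtr0_norm ?invr_gt0// /M [leRHS]mulrDl.
  apply: (@le_trans _ _ `|(T%:R - 1) / 2 * r ^+ 2 - e r|).
    by rewrite ler_piMl// invf_le1// ler1n.
  rewrite (le_trans (ler_normB _ _))// normrM (ger0_norm (sqr_ge0 r)) lerD2l.
  case/andP: r21 => r20 r21; rewrite (le_trans er)// ler_wpM2l ?(ltW C0)//.
  by rewrite (expr2 (r ^+ 2)) ler_piMl// ltW.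
Unshelve. all: by end_near.
Qed.
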